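(* Let $\Sigma$ be a connected surface and $\mathring\Sigma=\Sigma\setminus A$ with $A\subset\Sigma$ countable and dense. Then there are $2^{\aleph_0}$ many pairwise inequivalent connected regular covering projections $p_\alpha:\mathring\Sigma_\alpha\to\mathring\Sigma$, where each $\mathring\Sigma_\alpha$ is a perforated surface.
   Context: A surface is a paracompact 2-manifold without boundary. A perforated surface is the complement of a countable dense subset in a connected surface. Two coverings of $\mathring\Sigma$ are equivalent if there is a homeomorphism between the total spaces commuting with the projections to $\mathring\Sigma$. *)

(* Defs.v *)
From HB Require Import structures.
From mathcomp Require Import all_boot all_order all_algebra.
From mathcomp Require Import all_classical all_reals all_analysis.
Import numFieldNormedType.Exports.

Set Implicit Arguments.
Unset Strict Implicit.
Unset Printing Implicit Defensive.

Local Open Scope classical_set_scope.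

(* A subset [A : set X] is turned into a space through [set_type A], which
   the library equips with the subspace topology. *)

Definition homeomorphism (X Y : topologicalType) (f : X -> Y) : Prop :=
  continuous f /\
  exists g : Y -> X, [/\ continuous g, cancel f g & cancel g f].

Definition homeomorphic (X Y : topologicalType) : Prop :=
  exists f : X -> Y, homeomorphism f.

Definition locally_finite (X : topologicalType) (F : set (set X)) : Prop :=
  forall x : X,
    exists2 N, nbhs x N & finite_set [set V | F V /\ V `&` N !=set0].

(* Without the Hausdorff requirement, which [surface] states separately. *)
Definition paracompact (X : topologicalType) : Prop :=
  forall F : set (set X),
    F `<=` open -> \bigcup_(U in F) U = [set: X] ->
    exists G : set (set X),
      [/\ G `<=` open, \bigcup_(V in G) V = [set: X],
          forall V, G V -> exists2 U, F U & V `<=` U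
        & locally_finite G].

Definition locally_planar (R : realType) (X : topologicalType) : Prop :=
  forall x : X, exists (U : set X) (V : set (R * R)%type),
    [/\ open U, U x, open V & homeomorphic (set_type U) (set_type V)].

Definition surface (R : realType) (X : topologicalType) : Prop :=
  [/\ hausdorff_space X, paracompact X & locally_planar R X].

(* The library's [connected] holds for the empty set, hence the explicit
   nonemptiness. *)
Definition connected_surface (R : realType) (X : topologicalType) : Prop :=
  [/\ surface R X, [set: X] !=set0 & connected [set: X]].

Definition perforated_surface (R : realType) (X : topologicalType) : Prop :=
  exists (S : topologicalType) (A : set S),
    [/\ connected_surface R S, countable A, dense A
      & homeomorphic X (set_type (~` A))].

Section Coverings.
Variables E B : topologicalType.
Variable p : E -> B.

Definition evenly_covered (U : set B) : Prop :=
  exists F : set (set E),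
    [/\ F `<=` open, trivIset F id, p @^-1` U = \bigcup_(V in F) V
      & forall V, F V -> exists h : set_type V -> set_type U,
          homeomorphism h /\ forall v, \val (h v) = p (\val v)].

Definition covering_projection : Prop :=
  [/\ continuous p, range p = [set: B]
    & forall b : B, exists U : set B, [/\ open U, U b & evenly_covered U]].

Definition deck_transformation (h : E -> E) : Prop :=
  homeomorphism h /\ forall x, p (h x) = p x.

(* Regular (normal, Galois): the deck group is transitive on every fibre. *)
Definition regular_covering : Prop :=
  covering_projection /\
  forall x y, p x = p y -> exists2 h, deck_transformation h & h x = y.

Definition connected_regular_covering : Prop :=
  [/\ [set: E] !=set0, connected [set: E] & regular_covering].

End Coverings.

Definition equivalent_coverings (E1 E2 B : topologicalType)
    (p1 : E1 -> B) (p2 : E2 -> B) : Prop :=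
  exists h : E1 -> E2, homeomorphism h /\ forall x, p2 (h x) = p1 x.

(* Main.v *)
Require Import Defs.
From HB Require Import structures.
From mathcomp Require Import all_boot all_order all_algebra.
From mathcomp Require Import all_classical all_reals all_analysis.
From mathcomp Require Import ring lra.
Import numFieldNormedType.Exports.

Set Implicit Arguments.
Unset Strict Implicit.
Unset Printing Implicit Defensive.

Local Open Scope classical_set_scope.
Import Order.TTheory GRing.Theory Num.Theory.
Local Open Scope ring_scope.

(** A map f to the complex plane, continuous off a point a of A and with zeros
    in A only, defines the double cover {(x, w) | w^2 = f(x)} of Sigma \ A.
    Over the open set of the points x <> a with f(x) <> 0 the same formula
    defines a surface, of which the cover is the complement of the preimage of
    A.  Take disjoint discs in a chart, shrinking to a, and let f_alpha have
    two simple zeros of opposite winding, at points of A, in the n-th disc when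
    alpha switches this disc on, and be 1 elsewhere.  On a disc which is on,
    f_alpha has no continuous square root, even off A; on a disc which is off
    it has the root 1.  Hence an equivalence of the covers of alpha and beta
    forces alpha = beta.  The same obstruction, on one disc kept always on,
    makes the total spaces connected. *)

(** * Subspaces, connectedness and paracompactness *)

(** The opposite windings cancel around a disc, so f_alpha is 1 outside the discs and extends over
    [Sigma] whatever the topology of [Sigma]. When [Sigma] is compact the discs must accumulate, and
    f_alpha may be discontinuous where they do; they therefore shrink to a point of A, which is
    missing from the base anyway. The surface omits the points over a and over the zeros of f_alpha.
    These lie over A, and the rest of the preimage of A is still countable and dense, so the
    complement is unaffected.

    An equivalence covers the identity and can thus be tested on a single disc: it carries the
    section w = 1 over a disc that is off to a square root over the same disc. As A is dense, the
    base contains no disc at all; the absence of a root is proved from the connectedness of half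
    discs minus a countable set. Finally, an open subset of a paracompact space need not be
    paracompact, hence the continuous function [defect], positive exactly off a and the zeros of
    f_alpha. *)

Definition locally_constant_on (X : topologicalType) (C P : set X) :=
  forall x, C x -> \forall y \near x, C y -> (P y <-> P x).

(** Connectedness is used below as a principle of propagation: what passes between nearby points of
    C in both directions passes to all of C. The link is that the locally constant properties are
    the relatively clopen subsets. *)
Lemma connected_locally_constantP (X : topologicalType) (C : set X) :
  connected C <->
  forall P, locally_constant_on C P -> forall x y, C x -> C y -> P x -> P y.
Proof.
split=> [conC P lcP x y Cx Cy Px|lcC B [x Bx] [W oW BW] [K cK BK]].
  suff CP : C `&` P = C by have [] : (C `&` P) y by rewrite CP.
  apply: conC; first by exists x.
      exists (interior [set z | C z -> P z]); first exact: open_interior.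
      rewrite eqEsubset; split=> z [Cz Pz]; split=> //.
        by apply: filterS (lcP z Cz) => t Pt Ct; apply/(Pt Ct).
      exact: (nbhs_singleton Pz).
    exists (~` interior [set z | C z -> ~ P z]).
      exact/open_closedC/open_interior.
    rewrite eqEsubset; split=> z [Cz Pz]; split=> //.
      by move/nbhs_singleton => /(_ Cz).
    apply: contrapT => nPz; apply: Pz.
    by apply: filterS (lcP z Cz) => t Pt Ct /(Pt Ct).
have Cx : C x by move: Bx; rewrite BW => -[].
have BC : B `<=` C by rewrite BW; exact: subIsetl.
rewrite eqEsubset; split=> // y Cy.
apply: (lcC B _ x y) => // z Cz.
have [Bz|nBz] := pselect (B z).
  have /open_nbhs_nbhs : open_nbhs z W by split=> //; move: Bz; rewrite BW => -[].
  by apply: filterS => t Wt Ct; split=> // _; rewrite BW.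
have /open_nbhs_nbhs : open_nbhs z (~` K).
  by split; [exact: closed_openC | move=> Kz; apply: nBz; rewrite BK].
apply: filterS => t Ot Ct; split=> //.
by rewrite BK => -[_ /Ot].
Qed.

Section SetType.
Variables (X : topologicalType) (P : set X).

Lemma nbhs_set_typeP (x : set_type P) (N : set (set_type P)) :
  nbhs x N <->
  exists2 M, nbhs (\val x) M & forall y : set_type P, M (\val y) -> N y.
Proof.
split=> [[B [[W oW <-] Wx BN]]|[M nM MN]].
  exists W; first by apply: open_nbhs_nbhs; split.
  by move=> y Wy; apply: BN.
move: nM; rewrite nbhsE => -[W [oW Wx] WM].
exists (\val @^-1` W); split=> //; first by exists W.
by move=> y Wy; apply/MN/WM.
Qed.

Lemma continuous_val : continuous (\val : set_type P -> X).
Proof. by move=> x N nN; apply/nbhs_set_typeP; exists N. Qed.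

Lemma continuous_into (Y : topologicalType) (f : Y -> set_type P) (y : Y) :
  continuous_at y (fun z => \val (f z)) -> continuous_at y f.
Proof.
move=> cf N /nbhs_set_typeP[M nM MN].
have nV : nbhs y [set z | M (\val (f z))] := cf _ nM.
suff : nbhs y [set z | N (f z)] by [].
by apply: filterS nV => z Mz; exact: MN.
Qed.

End SetType.

Lemma set_type_inj (T : Type) (P : set T) (x y : set_type P) :
  \val x = \val y -> x = y.
Proof. exact: val_inj. Qed.

Lemma set_typeP (T : Type) (P : set T) (x : set_type P) : P (\val x).
Proof. exact: set_valP. Qed.

Definition set_mk (T : Type) (P : set T) (x : T) (Px : P x) : set_type P :=
  exist _ x (mem_set Px).

(** Serves both for the sheets of a covering and for the charts of a total space. The map is total,
    with control on U only. *)
Lemma open_embedding (S T : topologicalType) (g : S -> T) (U : set S)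
    (V : set T) :
  open U -> g @` U = V ->
  (forall x, U x -> continuous_at x g) ->
  (forall x y, U x -> U y -> g x = g y -> x = y) ->
  (forall x, U x -> forall N, nbhs x N -> nbhs (g x) (g @` N)) ->
  open V /\
  exists h : set_type U -> set_type V,
    homeomorphism h /\ forall u, \val (h u) = g (\val u).
Proof.
move=> oU <- cg ig og; split.
  rewrite openE => _ [x Ux <-]; apply: (og x) => //.
  exact: open_nbhs_nbhs.
have Vg (u : set_type U) : (g @` U) (g (\val u)).
  by exists (\val u) => //; exact: set_typeP.
have Ug (v : set_type (g @` U)) : exists u : set_type U, g (\val u) = \val v.
  by have [x Ux <-] := set_typeP v; exists (set_mk Ux).
have [k kP] := choice Ug.
pose h u := set_mk (Vg u); exists h; split=> //.
have hk : cancel k h by move=> v; apply: set_type_inj; rewrite /= kP.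
have kh : cancel h k.
  move=> u; apply: set_type_inj.
  by apply: ig; [exact: set_typeP|exact: set_typeP|rewrite kP].
split.
  move=> u; apply: continuous_into => /=.
  apply: (@continuous_comp _ _ _ (\val : set_type U -> S) g).
    exact: continuous_val.
  exact: cg (set_typeP _).
exists k; split=> // v N /nbhs_set_typeP[M nM MN].
apply/nbhs_set_typeP; exists (g @` (M `&` U)).
  rewrite -kP; apply: og; first exact: set_typeP.
  apply: filterI => //; apply: open_nbhs_nbhs; split=> //; exact: set_typeP.
move=> w [x [Mx Ux] xw]; apply: MN.
suff -> : \val (k w) = x by [].
by apply: ig; [exact: set_typeP| |rewrite kP].
Qed.

Lemma locally_finite_shells (X : topologicalType) (G : nat -> set (set X))
    (x : X) (m : nat) :
  (forall n, locally_finite (G n)) ->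
  exists2 N, nbhs x N &
    forall n, (n <= m)%N -> finite_set [set V | G n V /\ V `&` N !=set0].
Proof.
move=> lfG; elim: m => [|m [N nN fN]].
  by have [N nN fN] := lfG 0%N x; exists N => // n; rewrite leqn0 => /eqP ->.
have [M nM fM] := lfG m.+1 x; exists (N `&` M); first exact: filterI.
move=> n; rewrite leq_eqVlt => /orP[/eqP ->|/fN].
  by apply: sub_finite_set fM => V [GV [y [Vy [Ny My]]]]; split=> //; exists y.
by apply: sub_finite_set => V [GV [y [Vy [Ny My]]]]; split=> //; exists y.
Qed.

(** S lies over the open set { d > 0 }, which d exhibits as a countable union of closed sets; this
    is what lets the locally finite refinements on X, one for each shell, be assembled. As q may
    have several sheets, finitely many members of F are allowed over W. *)
Lemma paracompact_pull (R : realType) (S X : topologicalType) (q : S -> X)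
    (d : X -> R) :
  paracompact X -> continuous q -> continuous d -> (forall s, 0 < d (q s)) ->
  (forall F : set (set S), F `<=` open -> \bigcup_(U in F) U = [set: S] ->
    forall x, 0 < d x -> exists (W : set X) (H : set (set S)),
      [/\ open W, W x, finite_set H, H `<=` F
        & q @^-1` W `<=` \bigcup_(U in H) U]) ->
  paracompact S.
Proof.
move=> pX cq cd dq fibq F oF covF.
pose good (V : set X) := exists H : set (set S),
  [/\ finite_set H, H `<=` F & q @^-1` V `<=` \bigcup_(U in H) U].
have /choice[HV HVP] (V : set X) : exists H : set (set S),
    [/\ finite_set H, H `<=` F & good V -> q @^-1` V `<=` \bigcup_(U in H) U].
  have [[H [fH HF cH]]|ngV] := pselect (good V); first by exists H.
  by exists set0; split.
(* The shells [O n] avoid the neighbourhood [Z n] of the zero set of [d]. *)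
pose O (n : nat) := [set x | (n%:R - 1) * d x < 1 < (n%:R + 1) * d x].
pose Z (n : nat) := [set x | (n%:R + 2) * d x < 1].
have oZ n : open (Z n).
  apply: (open_comp _ (@open_lt R 1)) => x _.
  by apply: cvgMl_tmp; exact: cd.
have oO n : open (O n).
  rewrite (_ : O n = [set x | (n%:R - 1) * d x < 1] `&` [set x | 1 < (n%:R + 1) * d x]).
    apply: openI.
      by apply: (open_comp _ (@open_lt R 1)) => x _; apply: cvgMl_tmp; exact: cd.
    by apply: (open_comp _ (@open_gt R 1)) => x _; apply: cvgMl_tmp; exact: cd.
  by rewrite eqEsubset; split=> x /=; [move/andP|move=> [? ?]; apply/andP].
have OZ n x : O n x -> Z n x -> False.
  rewrite /O /Z /= => /andP[_ d1] d2.
  have n0 : 0 <= n%:R :> R by [].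
  have : 0 < d x by rewrite -(@pmulr_rgt0 _ (n%:R + 1)); lra.
  nra.
have /choice[G GP] (n : nat) : exists G : set (set X),
    [/\ G `<=` open, \bigcup_(V in G) V = [set: X],
      forall V, G V -> V `<=` Z n \/ good V & locally_finite G].
  (* Adding [Z n] turns the good open sets into a cover of X. Members of the refinement inside [Z n]
     do no harm, since they miss [O n]. *)
  have [||G [oG cG rG lG]] := pX ([set Z n] `|` [set W | open W /\ good W]).
  - by move=> W [->|[]].
  - rewrite -subTset => x _; have [dx|dx] := ltP 0 (d x).
      have [W [H [oW Wx fH HF cH]]] := fibq F oF covF x dx.
      by exists W => //; right; split=> //; exists H.
    exists (Z n); first by left.
    rewrite /Z /=.
    have n0 : 0 <= n%:R :> R by [].
    nra.
  exists G; split=> // V GV; have [W [->|[oW [H [fH HF cH]]]] VW] := rG V GV.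
    by left.
  by right; exists H; split=> // s Vs; apply: cH; exact: VW.
pose GG := [set B : set S | exists n V U, [/\ G n V, good V, HV V U
  & B = q @^-1` (V `&` O n) `&` U]].
exists GG; split.
- move=> _ [n [V [U [GV gV HU ->]]]].
  apply: openI.
    apply: open_comp => [? _|]; first exact: cq.
    by apply: openI; [have [+ _ _ _] := GP n; exact|exact: oO].
  by apply: oF; have [_ + _] := HVP V; exact.
- rewrite -subTset => s _.
  have [n On] : exists n, O n (q s).
    have dqs := dq s.
    pose t := (d (q s))^-1.
    have t0 : 0 <= t by rewrite invr_ge0 ltW.
    exists (Num.truncn t).
    have /andP[h1 h2] := truncn_itv t0.
    have td : t * d (q s) = 1 by rewrite mulVf // gt_eqF.
    rewrite /O /=.
    rewrite -natr1 in h2.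
    apply/andP; split.
      by rewrite -[X in _ < X]td ltr_pM2r //; lra.
    by rewrite -[X in X < _]td ltr_pM2r //; lra.
  have [oG cG dG _] := GP n.
  have [V GV Vs] : (\bigcup_(V in G n) V) (q s) by rewrite cG.
  have [VZ|gV] := dG V GV; first by case: (OZ n (q s)) => //; exact: VZ.
  have [_ _ /(_ gV)] := HVP V => /(_ s Vs)[U HU Us].
  by exists (q @^-1` (V `&` O n) `&` U) => //; exists n, V, U.
- move=> _ [n [V [U [GV gV HU ->]]]].
  exists U; last by move=> s [].
  by have [_ + _] := HVP V; exact.
move=> s.
have dqs := dq s.
pose m := (Num.truncn (d (q s))^-1).+1.
have md : 1 < m%:R * d (q s).
  have t0 : 0 <= (d (q s))^-1 by rewrite invr_ge0 ltW.
  have /andP[_ h2] := truncn_itv t0.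
  by rewrite -[X in X < _](mulVf (lt0r_neq0 dqs)) ltr_pM2r.
have [N nN fN] := @locally_finite_shells X G (q s) m.+1
  (fun n => let: And4 _ _ _ h := GP n in h).
have nM : nbhs (q s) [set x | 1 < m%:R * d x].
  apply: open_nbhs_nbhs; split=> //.
  by apply: (open_comp _ (@open_gt R 1)) => x _; apply: cvgMl_tmp; exact: cd.
exists (q @^-1` (N `&` [set x | 1 < m%:R * d x])).
  by apply: cq; exact: filterI.
(* Where 1 < m d, only shells with n - 1 < m are met. *)
apply: (@sub_finite_set _ _ (\bigcup_(n in `I_m.+2)
   \bigcup_(V in [set V | G n V /\ V `&` N !=set0])
   ((fun U => q @^-1` (V `&` O n) `&` U) @` HV V))).
  move=> _ [[n [V [U [GV gV HU ->]]]] [t [[[Vt Ont] Ut] [Nt mt]]]].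
  exists n => /=.
    move: Ont mt; rewrite /O /= => /andP[h1 _] mt.
    have n0 : 0 <= n%:R :> R by [].
    have dt := dq t.
    have : (n%:R - 1) * d (q t) < m%:R * d (q t) by lra.
    by rewrite ltr_pM2r // ltrBlDr natr1 ltr_nat => /leq_trans; apply.
  by exists V; [split=> //; exists (q t)|exists U].
apply: bigcup_finite => [|n nm]; first exact: finite_II.
apply: bigcup_finite => [|V _]; first by apply: fN; rewrite -ltnS.
by apply: finite_image; have [] := HVP V.
Qed.

(** * The plane *)

Section Plane.
Variable R : realType.
Implicit Types (z w p r : R * R).

Lemma countable_image (T U : Type) (f : T -> U) (A : set T) :
  countable A -> countable (f @` A).
Proof. by move=> cA; apply: sub_countable cA; exact: card_image_le. Qed.

Lemma itv_not_countable (B : set R) (a b : R) :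
  countable B -> a < b -> exists t, a < t < b /\ ~ B t.
Proof.
move=> cB ab; apply: contrapT => nt.
have sB : `]a, b[%classic `<=` B.
  move=> t /=; rewrite in_itv /= => tab; apply: contrapT => nBt.
  by apply: nt; exists t.
have cI : countable `]a, b[%classic.
  by apply: sub_countable cB; exact: subset_card_le.
have := countable_lebesgue_measure0 cI.
rewrite lebesgue_measure_itv /= lte_fin ab => -[] /eqP.
by rewrite subr_eq0 gt_eqF.
Qed.

Lemma plane_continuous1 z : continuous_at z (fun p : R * R => p.1).
Proof. exact: cvg_fst. Qed.

Lemma plane_continuous2 z : continuous_at z (fun p : R * R => p.2).
Proof. exact: cvg_snd. Qed.

End Plane.

Lemma continuous_pair (X Y Z : topologicalType) (f : X -> Y) (g : X -> Z) (x : X) :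
  continuous_at x f -> continuous_at x g ->
  continuous_at x (fun y => (f y, g y)).
Proof. by move=> cf cg; exact: (cvg_pair cf cg). Qed.

Lemma continuous_exp (R : realType) (X : topologicalType) (f : X -> R) n (x : X) :
  continuous_at x f -> continuous_at x (fun y => f y ^+ n).
Proof.
move=> cf; elim: n => [|n IH]; first exact: cvg_cst.
suff : (fun y => f y * f y ^+ n) @ x --> f x * f x ^+ n.
  rewrite -exprS; suff -> : (fun y => f y * f y ^+ n) = (fun y => f y ^+ n.+1) by [].
  by apply/funext => y; rewrite exprS.
exact: cvgM.
Qed.

Lemma continuous_addr (R : realType) (X : topologicalType) (f g : X -> R) (x : X) :
  continuous_at x f -> continuous_at x g ->
  continuous_at x (fun y => f y + g y).
Proof. by move=> cf cg; exact: cvgD. Qed.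

Lemma continuous_oppr (R : realType) (X : topologicalType) (f : X -> R) (x : X) :
  continuous_at x f -> continuous_at x (fun y => - f y).
Proof. by move=> cf; exact: cvgN. Qed.

Lemma continuous_mulr (R : realType) (X : topologicalType) (f g : X -> R) (x : X) :
  continuous_at x f -> continuous_at x g ->
  continuous_at x (fun y => f y * g y).
Proof. by move=> cf cg; exact: cvgM. Qed.

Lemma continuous_const (X Y : topologicalType) (c : Y) (x : X) :
  continuous_at x (fun=> c).
Proof. exact: cvg_cst. Qed.

Lemma continuous_idfun (X : topologicalType) (x : X) :
  continuous_at x (fun y => y).
Proof. exact: cvg_id. Qed.

Lemma continuous_minr (R : realType) (X : topologicalType) (f g : X -> R) (x : X) :
  continuous_at x f -> continuous_at x g ->
  continuous_at x (fun y => Num.min (f y) (g y)).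
Proof. exact: (@continuous_min R X f g x). Qed.

Lemma continuous_maxr (R : realType) (X : topologicalType) (f g : X -> R) (x : X) :
  continuous_at x f -> continuous_at x g ->
  continuous_at x (fun y => Num.max (f y) (g y)).
Proof. exact: (@continuous_max R X f g x). Qed.

Ltac continuity := repeat lazymatch goal with
  |- @continuous_at _ _ _ ?f => lazymatch f with
    | fun _ => ?c => exact: continuous_const
    | fun y => y => exact: continuous_idfun
    | id => exact: continuous_idfun
    | @Algebra.opp _ => exact: (continuous_oppr (@continuous_idfun _ _))
    | @Algebra.add _ ?c =>
      exact: (continuous_addr (@continuous_const _ _ c _) (@continuous_idfun _ _))
    | @GRing.mul _ ?c =>
      exact: (continuous_mulr (@continuous_const _ _ c _) (@continuous_idfun _ _))
    | fst => exact: plane_continuous1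
    | snd => exact: plane_continuous2
    | fun y => @fst _ _ y => exact: plane_continuous1
    | fun y => @snd _ _ y => exact: plane_continuous2
    | fun y => @pair _ _ (@?a y) (@?b y) => apply: continuous_pair
    | fun y => @Algebra.add _ (@?a y) (@?b y) => apply: continuous_addr
    | fun y => @Algebra.opp _ (@?a y) => apply: continuous_oppr
    | fun y => @GRing.mul _ (@?a y) (@?b y) => apply: continuous_mulr
    | fun y => @GRing.exp _ (@?a y) _ => apply: continuous_exp
    | fun y => @Order.min _ _ (@?a y) (@?b y) => apply: continuous_minr
    | fun y => @Order.max _ _ (@?a y) (@?b y) => apply: continuous_maxr
    end
  end.

Section PlaneTopology.
Variable R : realType.
Implicit Types (z w p r : R * R).

Lemma near_gt0 (X : topologicalType) (g : X -> R) (x : X) :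
  continuous_at x g -> 0 < g x -> \forall y \near x, 0 < g y.
Proof.
move=> cg g0.
have : nbhs (g x) [set t | 0 < t] by apply: open_nbhs_nbhs; split=> //; exact: open_gt.
by move/cg.
Qed.

Lemma open_gt0 (X : topologicalType) (g : X -> R) :
  (forall x, continuous_at x g) -> open [set x | 0 < g x].
Proof. by move=> cg; rewrite openE => x /= gx; exact: near_gt0. Qed.

(** Two points of W are joined inside W by uncountably many arcs that meet in their end points only,
    and a countable set cannot block them all. *)
Lemma connected_convex_minus_countable (W A : set (R * R)) :
  open W ->
  (forall p r s, W p -> W r -> 0 <= s <= 1 ->
    W ((1 - s) * p.1 + s * r.1, (1 - s) * p.2 + s * r.2)) ->
  countable A -> connected (W `\` A).
Proof.
move=> oW cvW cA; apply/connected_locally_constantP => P lcP.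
move=> [p1 p2] [q1 q2] [Wp nAp] [Wq nAq].
have [->//|pq] := eqVneq (p1, p2) (q1, q2).
have n0 : 0 < (q1 - p1) ^+ 2 + (q2 - p2) ^+ 2.
  rewrite lt0r paddr_eq0 ?sqr_ge0 // !sqrf_eq0 !subr_eq0 addr_ge0 ?sqr_ge0 // andbT.
  by apply: contra pq => /andP[/eqP -> /eqP ->].
set n := _ + _ in n0.
(* [gam t] is the Bezier parabola with end points [p], [q] and control point
   [M t]; a point off the end points lies on [gam t] for at most one [t]. *)
pose M t := ((p1 + q1) / 2 - t / 2 * (q2 - p2), (p2 + q2) / 2 + t / 2 * (q1 - p1)).
pose gam t s := ((1 - s) * p1 + s * q1 - t * s * (1 - s) * (q2 - p2),
  (1 - s) * p2 + s * q2 + t * s * (1 - s) * (q1 - p1)).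
(* [sigma] and [tau] recover s and t from [gam t s], the latter when s is neither 0 nor 1. The image
   of A under [tau] thus contains every t to be avoided. *)
pose sigma (a : R * R) := ((a.1 - p1) * (q1 - p1) + (a.2 - p2) * (q2 - p2)) / n.
pose tau (a : R * R) := ((q1 - p1) * (a.2 - p2) - (q2 - p2) * (a.1 - p1)) /
  (sigma a * (1 - sigma a) * n).
have nM : nbhs (0 : R) [set t | W (M t)].
  have cM : continuous_at 0 M by rewrite /M; continuity.
  apply: cM; apply: open_nbhs_nbhs; split=> //.
  have := cvW _ _ (1 / 2) Wp Wq; rewrite /M /=.
  suff -> : ((p1 + q1) / 2 - 0 / 2 * (q2 - p2), (p2 + q2) / 2 + 0 / 2 * (q1 - p1)) =
    ((1 - 1 / 2) * p1 + 1 / 2 * q1, (1 - 1 / 2) * p2 + 1 / 2 * q2) by apply; lra.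
  by congr pair; field.
have [e /= e0 eM] := (nbhs_ballP _ _).1 nM.
have [t [/andP[t0 te] tA]] := itv_not_countable (countable_image tau cA) e0.
have WM : W (M t) by apply: eM; rewrite /ball /= sub0r normrN gtr0_norm.
have gamW s : 0 <= s <= 1 -> W (gam t s).
  move=> s01.
  (* De Casteljau's construction: nested convex combinations of weight s give the point of the
     parabola. *)
  have := cvW _ _ s (cvW _ _ s Wp WM s01) (cvW _ _ s WM Wq s01) s01.
  by congr W; rewrite /gam /M /=; congr pair; field.
have gamA s : 0 <= s <= 1 -> ~ A (gam t s).
  move=> s01 Ag.
  have sg : sigma (gam t s) = s.
    rewrite /sigma /gam /n /=; field.
    by rewrite -/n lt0r_neq0.
  have [s0|s0] := eqVneq s 0.
    by apply: nAp; move: Ag; rewrite s0 /gam; congr A; congr pair; ring.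
  have [s1|s1] := eqVneq s 1.
    by apply: nAq; move: Ag; rewrite s1 /gam; congr A; congr pair; ring.
  apply: tA; exists (gam t s) => //.
  rewrite /tau sg /gam /= /n; field.
  by rewrite -/n (lt0r_neq0 n0) s0 subr_eq0 eq_sym s1.
have Q01 s : `[0, 1]%classic s -> (W `\` A) (gam t s).
  by rewrite /= in_itv /= => s01; split; [exact: gamW|exact: gamA].
have g0 : gam t 0 = (p1, p2) by rewrite /gam; congr pair; ring.
have g1 : gam t 1 = (q1, q2) by rewrite /gam; congr pair; ring.
rewrite -g0 -g1.
have /connected_locally_constantP/(_ [set s | P (gam t s)]) := @segment_connected R 0 1.
move=> /(_ _ 0 1); apply; last 2 first.
- by rewrite /= in_itv /= lexx ler01.
- by rewrite /= in_itv /= lexx ler01.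
move=> s /Q01 /lcP near_gs.
have cg : continuous_at s (gam t).
  by rewrite /gam /=; continuity.
have : \forall u \near s, (W `\` A) (gam t u) -> (P (gam t u) <-> P (gam t s)) :=
  cg _ near_gs.
by apply: filterS => u h /Q01 /h.
Qed.

Lemma open_minus_countable (W A : set (R * R)) :
  open W -> W !=set0 -> countable A -> W `\` A !=set0.
Proof.
move=> oW [[p1 p2] Wp] cA.
have cg : continuous_at p1 (fun t : R => (t, p2)) by continuity.
have [e /= e0 eW] := (nbhs_ballP _ _).1 (cg _ (open_nbhs_nbhs (conj oW Wp))).
have [t [/andP[t0 te] tA]] :
    exists t, p1 < t < p1 + e /\ ~ [set a.1 | a in A] t.
  by apply: itv_not_countable; [exact: countable_image|rewrite ltrDl].
exists (t, p2); split; last by move=> At; apply: tA; exists (t, p2).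
by apply: eW; rewrite /ball /= ltr0_norm ?subr_lt0 //; lra.
Qed.

(* The plane stands for the complex numbers, and [sq] is z |-> z^2. *)
Definition sq z := (z.1 ^+ 2 - z.2 ^+ 2, 2 * z.1 * z.2).

Lemma sq_surj z : exists r, sq r = z.
Proof.
case: z => x y.
pose m := Num.sqrt (x ^+ 2 + y ^+ 2).
have m0 : 0 <= m by exact: sqrtr_ge0.
have mE : m ^+ 2 = x ^+ 2 + y ^+ 2 by rewrite sqr_sqrtr // addr_ge0 ?sqr_ge0.
have mx : `|x| <= m by rewrite -ler_sqr ?nnegrE // mE real_normK ?num_real // lerDl sqr_ge0.
have [u0 v0] : 0 <= (m + x) / 2 /\ 0 <= (m - x) / 2.
  by move: mx; rewrite ler_norml => /andP[? ?]; split; lra.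
set u := Num.sqrt ((m + x) / 2); set v := Num.sqrt ((m - x) / 2).
have uE : u ^+ 2 = (m + x) / 2 by rewrite sqr_sqrtr.
have vE : v ^+ 2 = (m - x) / 2 by rewrite sqr_sqrtr.
have uv : 2 * u * v = `|y|.
  apply/eqP; rewrite -(@eqrXn2 _ 2) // ?mulr_ge0 ?sqrtr_ge0 //.
  rewrite !exprMn uE vE real_normK ?num_real //; apply/eqP.
  have -> : y ^+ 2 = m ^+ 2 - x ^+ 2 by rewrite mE; ring.
  by field.
have [y0|y0] := leP 0 y.
  exists (u, v); rewrite /sq /= uE vE uv ger0_norm //; congr pair.
  by field.
exists (u, - v); rewrite /sq /= sqrrN uE vE mulrN uv ltr0_norm // opprK; congr pair.
by field.
Qed.

Lemma sqN z : sq (- z) = sq z.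
Proof. by rewrite /sq /= !sqrrN mulrN mulrN mulNr opprK. Qed.

Definition nsq z := z.1 ^+ 2 + z.2 ^+ 2.

Lemma nsq_ge0 z : 0 <= nsq z.
Proof. by rewrite addr_ge0 ?sqr_ge0. Qed.

Lemma nsq_eq0 z : (nsq z == 0) = (z == 0).
Proof. by case: z => x y; rewrite /nsq paddr_eq0 ?sqr_ge0 // !sqrf_eq0. Qed.

Lemma nsq_sq z : nsq (sq z) = nsq z ^+ 2.
Proof. by rewrite /nsq /sq /=; ring. Qed.

Lemma sq_eq0 z : (sq z == 0) = (z == 0).
Proof. by rewrite -(nsq_eq0 (sq z)) nsq_sq sqrf_eq0 nsq_eq0. Qed.

(** Multiplicativity of the modulus on (z - w)(z + w). It yields the injectivity of [sq] up to sign
    and the estimate behind [sq_open]. *)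
Lemma nsq_sqB z w : nsq (z - w) * nsq (z + w) = nsq (sq z - sq w).
Proof. by rewrite /nsq /sq /=; ring. Qed.

Lemma sq_inj z w : sq z = sq w -> z = w \/ z = - w.
Proof.
move=> zw; have /eqP := nsq_sqB z w; rewrite zw subrr.
have -> : nsq (0 : R * R) = 0 by apply/eqP; rewrite nsq_eq0.
rewrite mulf_eq0 !nsq_eq0 subr_eq0 addr_eq0 => /orP[/eqP ->|/eqP ->]; first by left.
by right.
Qed.

(** The real inner product. Its sign against a fixed vector tells the roots r and -r apart, so
    sheets can be selected without a branch of the square root. *)
Definition dot z w := z.1 * w.1 + z.2 * w.2.

Lemma dotN z w : dot (- z) w = - dot z w.
Proof. by rewrite /dot /=; ring. Qed.

Lemma dotNr z w : dot z (- w) = - dot z w.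
Proof. by rewrite /dot /=; ring. Qed.

Lemma dot_gt0 z : (0 < dot z z) = (z != 0).
Proof. by rewrite /dot -!expr2 -/(nsq z) lt0r nsq_eq0 nsq_ge0 andbT. Qed.

Lemma dot_continuous w : continuous (dot ^~ w).
Proof.
move=> z; suff : continuous_at z (fun v : R * R => v.1 * w.1 + v.2 * w.2) by [].
by continuity.
Qed.

Lemma nsq_continuous : continuous nsq.
Proof.
move=> z; suff : continuous_at z (fun v : R * R => v.1 ^+ 2 + v.2 ^+ 2) by [].
by continuity.
Qed.

Lemma ltr_norm_sqrD (x y e : R) : 0 < e -> x ^+ 2 + y ^+ 2 < e ^+ 2 -> `|x| < e.
Proof.
move=> e0 xy; have := sqr_ge0 y.
by rewrite ltr_norml => y0; apply/andP; split; nra.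
Qed.

(** The root r of z on the side of w satisfies |r + w| >= |w|, hence |r - w| <= |z - w^2| / |w|. *)
Lemma sq_open w N :
  w != 0 -> nbhs w N -> \forall z \near sq w, exists2 r, N r & sq r = z.
Proof.
move=> w0 /nbhs_ballP[e /= e0 eN].
have n0 : 0 < nsq w by rewrite lt0r nsq_eq0 w0 nsq_ge0.
have c z : continuous_at z (fun z => e ^+ 2 * nsq w - nsq (z - sq w)).
  by rewrite /nsq /=; continuity.
have : 0 < e ^+ 2 * nsq w - nsq (sq w - sq w).
  rewrite subrr (eqP (_ : nsq 0 == 0)) ?nsq_eq0 // subr0 mulr_gt0 // exprn_gt0 //.
move/(near_gt0 (c _)); apply: filterS => z zlt.
have [r [rz rw]] : exists r, sq r = z /\ 0 <= dot r w.
  have [r rz] := sq_surj z; have [rw|rw] := leP 0 (dot r w); first by exists r.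
  by exists (- r); rewrite sqN dotN oppr_ge0 ltW.
exists r => //; apply: eN.
have : nsq (r - w) < e ^+ 2.
  rewrite -(ltr_pM2r n0); apply: le_lt_trans (_ : nsq (r - w) * nsq (r + w) < _).
    rewrite ler_wpM2l ?nsq_ge0 //.
    have -> : nsq (r + w) = nsq r + nsq w + 2 * dot r w by rewrite /nsq /dot /=; ring.
    have := nsq_ge0 r; lra.
  by rewrite nsq_sqB rz -subr_gt0.
rewrite /nsq /= => lt.
split; rewrite /ball /= distrC; first exact: ltr_norm_sqrD e0 lt.
by apply: (@ltr_norm_sqrD _ (r.1 - w.1)) => //; rewrite addrC.
Qed.

(** Roots will arise as total maps with arbitrary values off C, so continuity is asked along C
    only. *)
Definition continuous_on (X Y : topologicalType) (C : set X) (g : X -> Y) :=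
  forall x, C x -> forall N, nbhs (g x) N -> \forall y \near x, C y -> N (g y).

Lemma continuous_at_on (X Y : topologicalType) (C : set X) (g : X -> Y) :
  (forall x, C x -> continuous_at x g) -> continuous_on C g.
Proof.
move=> cg x Cx N nN; have ng : nbhs x (g @^-1` N) := cg x Cx N nN.
by apply: filterS ng => y Ny _.
Qed.

(* Its only zeros are (1, 0) and (-1, 0), where its winding numbers are odd,
   and it is constant on [nsq z >= 2]. *)
Definition dipole z :=
  (Num.min 1 (nsq z - 1), z.2 * Num.max 0 (2 - nsq z)).

Lemma dipole_continuous : continuous dipole.
Proof.
move=> z.
suff : continuous_at z (fun v : R * R =>
  (Num.min 1 (nsq v - 1), v.2 * Num.max 0 (2 - nsq v))) by [].
by rewrite /nsq; continuity.
Qed.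

Lemma dipole_far z : 2 <= nsq z -> dipole z = (1, 0).
Proof.
move=> z2; rewrite /dipole min_l; last by lra.
by rewrite max_l ?mulr0 //; lra.
Qed.

Lemma dipole_eq0 z : dipole z = 0 -> z = (1, 0) \/ z = (-1, 0).
Proof.
have [z2|z2] := leP 2 (nsq z).
  by rewrite dipole_far // => /(congr1 fst) /= /eqP; rewrite oner_eq0.
case: z z2 => x y z2 h; have := congr1 fst h; have := congr1 snd h.
rewrite /= max_r; last by lra.
move/eqP; rewrite mulf_eq0 (gt_eqF (_ : 0 < 2 - nsq (x, y))) ?subr_gt0 // orbF => /eqP y0.
rewrite minEle; case: ifP => [_ /eqP|_ /eqP]; first by rewrite oner_eq0.
rewrite subr_eq0 /nsq /= y0 expr0n /= addr0.
by rewrite sqrf_eq1 => /orP[] /eqP ->; [left|right].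
Qed.

Lemma dipole_near z : nsq z < 2 -> dipole z = (nsq z - 1, z.2 * (2 - nsq z)).
Proof. by move=> z2; rewrite /dipole min_r ?max_r //; lra. Qed.

(* On the half disc [0 < sg * z.2] the sign of [w.1 * w.2] is that of [sg], so
   [w.1] keeps there the sign it has at [(x, 0)], and this forces the sign of
   [w.2] at [(y, 0)]. *)
Lemma dipole_root_half (A : set (R * R)) (w : R * R -> R * R) (x y sg : R) :
  countable A -> continuous_on ([set z | nsq z < 2] `\` A) w ->
  (forall z, nsq z < 2 -> ~ A z -> sq (w z) = dipole z) ->
  1 < x < 6 / 5 -> ~ A (x, 0) -> 0 < y < 1 -> ~ A (y, 0) -> sg ^+ 2 = 1 ->
  0 < sg * (w (x, 0)).1 * (w (y, 0)).2.
Proof.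
move=> cA cw rw /andP[x1 x2] Ax /andP[y0 y1] Ay sg2.
pose U := [set z : R * R | 0 < sg * z.2] `&` [set z | 0 < 2 - nsq z].
have oU : open U.
  by apply: openI; apply: open_gt0 => z; rewrite /nsq; continuity.
have UD z : U z -> nsq z < 2 by case=> _ /=; rewrite subr_gt0.
have conU : connected (U `\` A).
  apply: connected_convex_minus_countable => //.
  move=> [p1 p2] [r1 r2] s [/= p0 pn] [/= r0 rn] /andP[s0 s1]; split => /=.
    have [->|sn0] := eqVneq s 0; first by rewrite subr0 mul1r mul0r addr0.
    have : 0 < s by rewrite lt0r sn0.
    nra.
  rewrite /nsq /= in pn rn *.
  have : 0 <= s * (1 - s) * ((p1 - r1) ^+ 2 + (p2 - r2) ^+ 2).
    by rewrite mulr_ge0 ?addr_ge0 ?sqr_ge0 // mulr_ge0 // subr_ge0.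
  have [->|sn0] := eqVneq s 0; first by move=> _; rewrite subr0 !mul1r !mul0r !addr0.
  have : 0 < s by rewrite lt0r sn0.
  nra.
have rwE z : nsq z < 2 -> ~ A z ->
    (w z).1 ^+ 2 - (w z).2 ^+ 2 = nsq z - 1 /\
    2 * (w z).1 * (w z).2 = z.2 * (2 - nsq z).
  by move=> z2 Az; have := rw z z2 Az; rewrite dipole_near // => -[].
(* The points (t, 0) lie on the boundary of U; [touch] passes from them to nearby points of U off A,
   where signs persist by continuity. *)
have touch (t : R) (N : set (R * R)) : t ^+ 2 < 2 -> nbhs (t, 0) N ->
    exists z, [/\ U z, ~ A z & N z].
  move=> t2 nN.
  have [||z [[Uz /nbhs_singleton Nz] Az]] := @open_minus_countable (U `&` interior N) A _ _ cA.
  - by apply: openI => //; exact: open_interior.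
  - have cs : continuous_at 0 (fun u : R => (t, sg * u)) by continuity.
    have cn : continuous_at 0 (fun u : R => 2 - nsq (t, sg * u)).
      by rewrite /nsq /=; continuity.
    have ni : nbhs (0 : R) [set u | interior N (t, sg * u)].
      by apply: cs; rewrite mulr0; exact: nbhs_interior.
    have np : 0 < 2 - nsq (t, sg * 0) by rewrite /nsq /=; lra.
    have [e /= e0 eN] := (nbhs_ballP _ _).1 (filterI ni (near_gt0 cn np)).
    have [] : ([set u | interior N (t, sg * u)] `&`
        [set u | 0 < 2 - nsq (t, sg * u)]) (e / 2).
      by apply: eN; rewrite /ball /= sub0r normrN gtr0_norm; lra.
    move=> ? ?; exists (t, sg * (e / 2)); split=> //; split=> //=.
    by rewrite mulrA -expr2 sg2; lra.
  by exists z.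
have dx : nsq (x, 0) < 2 by rewrite /nsq /=; nra.
have dy : nsq (y, 0) < 2 by rewrite /nsq /=; nra.
have near_w t (k1 k2 : R) : nsq t < 2 -> ~ A t ->
    0 < k1 * (w t).1 + k2 * (w t).2 ->
    \forall z \near t, ([set z | nsq z < 2] `\` A) z -> 0 < k1 * (w z).1 + k2 * (w z).2.
  move=> t2 At kt; apply: (cw t _ [set v : R * R | 0 < k1 * v.1 + k2 * v.2]) => //.
  by apply: (near_gt0 (g := fun v : R * R => k1 * v.1 + k2 * v.2)) => //; continuity.
(* The dipole is positive at (x, 0), as x > 1, and negative at (y, 0), as y < 1. Its roots there are
   real and imaginary respectively, so the two coordinates in the conclusion are non-zero. *)
set c := (w (x, 0)).1.
have c0 : c != 0.
  have [h _] := rwE _ dx Ax; rewrite -/c in h.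
  apply: contraTneq isT => c0; rewrite c0 /nsq /= in h.
  have := sqr_ge0 (w (x, 0)).2; nra.
have cc : 0 < c ^+ 2 by rewrite lt0r sqrf_eq0 c0 sqr_ge0.
have prodU z : U z -> ~ A z -> 0 < sg * ((w z).1 * (w z).2).
  move=> Uz Az; have [_ h] := rwE z (UD z Uz) Az.
  case: Uz => /= u1 u2.
  have : 0 < (sg * z.2) * (2 - nsq z) by rewrite mulr_gt0.
  have -> : (sg * z.2) * (2 - nsq z) = 2 * (sg * ((w z).1 * (w z).2)).
    by rewrite -mulrA -h; ring.
  by rewrite pmulr_rgt0.
have cU : forall z, U z -> ~ A z -> 0 < c * (w z).1.
  have [z0 [Uz0 Az0 cz0]] : exists z, [/\ U z, ~ A z & 0 < c * (w z).1].
    have xx : x ^+ 2 < 2 by nra.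
    have ncx : \forall z \near (x, 0), ([set z | nsq z < 2] `\` A) z ->
        0 < c * (w z).1 + 0 * (w z).2.
      by apply: near_w; rewrite // -/c mul0r addr0 -expr2.
    have [z [Uz Az]] := touch x _ xx ncx.
    rewrite mul0r addr0 => h; exists z; split=> //; apply: h; split=> //; exact: UD.
  move=> z Uz Az.
  move/connected_locally_constantP: conU => /(_ [set z | 0 < c * (w z).1]).
  apply; last exact: cz0; [|by split|by split].
  move=> t [Ut At].
  have [ct|ct] := ltP 0 (c * (w t).1).
    have : 0 < c * (w t).1 + 0 * (w t).2 by rewrite mul0r addr0.
    move/(near_w _ _ _ (UD _ Ut) At); apply: filterS => u h [Uu Au].
    have := h (conj (UD _ Uu) Au); rewrite mul0r addr0 /= => ->.
    by rewrite ct.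
  have wt0 : (w t).1 != 0.
    by apply: contraTneq (prodU t Ut At) => ->; rewrite mul0r mulr0 ltxx.
  have : 0 < (- c) * (w t).1 + 0 * (w t).2.
    by rewrite mul0r addr0 mulNr oppr_gt0 lt_neqAle mulf_neq0.
  move/(near_w _ _ _ (UD _ Ut) At); apply: filterS => u h [Uu Au].
  have := h (conj (UD _ Uu) Au); rewrite mul0r addr0 mulNr oppr_gt0 /= => hu.
  by split=> hh; [have := lt_trans hh hu; rewrite ltxx|have := lt_le_trans hh ct; rewrite ltxx].
have dU z : U z -> ~ A z -> 0 < sg * c * (w z).2.
  move=> Uz Az; have := mulr_gt0 (cU z Uz Az) (prodU z Uz Az).
  have -> : c * (w z).1 * (sg * ((w z).1 * (w z).2)) = (w z).1 ^+ 2 * (sg * c * (w z).2).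
    by ring.
  rewrite pmulr_rgt0 // lt0r sqr_ge0 andbT sqrf_eq0.
  by apply: contraTneq (cU z Uz Az) => ->; rewrite mulr0 ltxx.
rewrite ltNge; apply/negP => le0.
have wy0 : (w (y, 0)).2 != 0.
  have [h _] := rwE _ dy Ay.
  apply: contraTneq isT => w0; rewrite w0 /nsq /= in h.
  have := sqr_ge0 (w (y, 0)).1; nra.
have lt0 : 0 < 0 * (w (y, 0)).1 + - (sg * c) * (w (y, 0)).2.
  rewrite mul0r add0r mulNr oppr_gt0 lt_neqAle le0 andbT !mulf_neq0 //.
  by rewrite -sqrf_eq0 sg2 oner_eq0.
have yy : y ^+ 2 < 2 by nra.
have [z [Uz Az]] := touch y _ yy (near_w _ _ _ dy Ay lt0).
move/(_ (conj (UD _ Uz) Az)); rewrite mul0r add0r mulNr oppr_gt0.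
by have := dU z Uz Az => h1 h2; have := lt_trans h1 h2; rewrite ltxx.
Qed.

(** The upper and lower half discs together surround the zero (1, 0): taken with sg = 1 and sg = -1,
    they give opposite signs to the same product. The bound 6 / 5 keeps (x, 0) in the disc. *)
Lemma dipole_no_root (A : set (R * R)) (w : R * R -> R * R) :
  countable A -> continuous_on ([set z | nsq z < 2] `\` A) w ->
  ~ (forall z, nsq z < 2 -> ~ A z -> sq (w z) = dipole z).
Proof.
move=> cA cw rw.
have cA1 : countable [set a.1 | a in A] by exact: countable_image.
have [x [x1 Ax]] : exists t : R, 1 < t < 6 / 5 /\ ~ [set a.1 | a in A] t.
  by apply: itv_not_countable => //; lra.
have [y [y1 Ay]] := itv_not_countable cA1 (@ltr01 R).
have {}Ax : ~ A (x, 0) by move=> Ax'; apply: Ax; exists (x, 0).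
have {}Ay : ~ A (y, 0) by move=> Ay'; apply: Ay; exists (y, 0).
have h1 := @dipole_root_half A w x y 1 cA cw rw x1 Ax y1 Ay (expr1n _ _).
have h2 := @dipole_root_half A w x y (-1) cA cw rw x1 Ax y1 Ay (sqrr_sign _ 1).
by move: h1 h2; lra.
Qed.

End PlaneTopology.

(** * Charts *)

Lemma nbhs_sub (X : topologicalType) (x : X) (P Q : set X) :
  nbhs x P -> P `<=` Q -> nbhs x Q.
Proof. by move=> nP PQ; exact: filterS nP. Qed.

Section Charts.
Variable R : realType.

Definition box (e : R) : set (R * R) := [set z | `|z.1| < e /\ `|z.2| < e].

(** An open embedding of [box 2], given as a total map. The dipoles will stay in [box 1], which
    leaves a collar where the functions built from them are constant. *)
Definition chart (X : topologicalType) (psi : R * R -> X) :=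
  [/\ forall z, box 2 z -> continuous_at z psi,
      forall z z', box 2 z -> box 2 z' -> psi z = psi z' -> z = z'
    & forall z N, box 2 z -> nbhs z N -> nbhs (psi z) (psi @` N)].

Lemma box_open e : open (box e).
Proof.
rewrite (_ : box e = [set z | 0 < e - `|z.1|] `&` [set z | 0 < e - `|z.2|]).
  apply: openI; apply: open_gt0 => z.
    apply: continuous_addr; first exact: continuous_const.
    apply: continuous_oppr.
    apply: (@continuous_comp _ _ _ (fun z : R * R => z.1) Num.norm).
      exact: plane_continuous1.
    exact: norm_continuous.
  apply: continuous_addr; first exact: continuous_const.
  apply: continuous_oppr.
  apply: (@continuous_comp _ _ _ (fun z : R * R => z.2) Num.norm).
    exact: plane_continuous2.
  exact: norm_continuous.
by rewrite eqEsubset; split=> z /=; rewrite !subr_gt0.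
Qed.

Lemma nbhs_box e z : box e z -> nbhs z (box e).
Proof. by move=> bz; apply: open_nbhs_nbhs; split=> //; exact: box_open. Qed.

Lemma box2_0 : box 2 0.
Proof. by rewrite /box /= normr0. Qed.

Lemma box_convex e p r s : box e p -> box e r -> 0 <= s <= 1 ->
  box e ((1 - s) * p.1 + s * r.1, (1 - s) * p.2 + s * r.2).
Proof.
rewrite /box /= !ltr_norml => -[/andP[? ?] /andP[? ?]] [/andP[? ?] /andP[? ?]].
move=> /andP[s0 s1].
have [->|sn0] := eqVneq s 0.
  by rewrite subr0 !mul1r !mul0r !addr0; split; apply/andP.
have : 0 < s by rewrite lt0r sn0.
by move=> ?; split; apply/andP; split; nra.
Qed.

Lemma locally_planar_chart (X : topologicalType) (x : X) :
  locally_planar R X -> exists2 psi : R * R -> X, chart psi & psi 0 = x.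
Proof.
move=> /(_ x)[U [V [oU Ux oV [h [ch [g [cg hg gh]]]]]]].
pose x0 := \val (h (set_mk Ux)).
have Vx0 : V x0 by exact: set_typeP.
have [e /= e0 eV] := (nbhs_ballP _ _).1 (open_nbhs_nbhs (conj oV Vx0)).
(* Coordinates are below 2 in absolute value on [box 2], so the factor e / 2 keeps [k z] in the ball
   of radius e about [x0]. *)
pose k (z : R * R) := (x0.1 + e / 2 * z.1, x0.2 + e / 2 * z.2).
pose k' (z : R * R) := ((z.1 - x0.1) / (e / 2), (z.2 - x0.2) / (e / 2)).
have en0 : e != 0 by rewrite gt_eqF.
have kk' : cancel k k'.
  by case=> a b; rewrite /k /k' /=; congr pair; field.
have k'k : cancel k' k.
  by case=> a b; rewrite /k /k' /= [x0]surjective_pairing /=; congr pair; field.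
have ck z : continuous_at z k by rewrite /k; continuity.
have ck' z : continuous_at z k' by rewrite /k'; continuity.
have kV z : box 2 z -> V (k z).
  move=> [z1 z2]; apply: eV; rewrite /ball /k /=.
  have h0 (a b : R) : `|b| < 2 -> `|a - (a + e / 2 * b)| < e.
    by rewrite !ltr_norml => /andP[? ?]; apply/andP; split; nra.
  by split; exact: h0.
(* By [kV] the default x is taken only off [box 2]. *)
pose psi z := if pselect (V (k z)) is left H then \val (g (set_mk H)) else x.
have psiE z (H : V (k z)) : psi z = \val (g (set_mk H)).
  by rewrite /psi; case: pselect => // H'; rewrite (Prop_irrelevance H' H).
exists psi; last first.
  have k0 : k 0 = x0 by rewrite /k /= !mulr0 !addr0 -surjective_pairing.
  have H : V (k 0) by rewrite k0.
  rewrite (psiE _ H).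
  have -> : set_mk H = h (set_mk Ux) by apply: set_type_inj; rewrite /= k0.
  by rewrite hg.
split.
- move=> z bz N nN; have H := kV z bz.
  have [M nM MN] : exists2 M, nbhs (k z) M &
      forall v : set_type V, M (\val v) -> N (\val (g v)).
    have /cg : nbhs (g (set_mk H)) [set u | N (\val u)].
      by apply: continuous_val; rewrite -(psiE z H).
    by move/nbhs_set_typeP.
  have nV : nbhs (k z) V by apply: open_nbhs_nbhs.
  have nMV : nbhs (k z) (M `&` V) by exact: filterI.
  have kMV : nbhs z [set z' | (M `&` V) (k z')] := ck z _ nMV.
  suff : nbhs z (psi @^-1` N) by [].
  apply: (nbhs_sub kMV).
  by move=> z' [Mz' Vz'] /=; rewrite (psiE _ Vz'); exact: MN.
- move=> z z' /kV H /kV H'; rewrite (psiE _ H) (psiE _ H').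
  move/set_type_inj/(congr1 h); rewrite !gh => /(congr1 val) /= kz.
  by rewrite -(kk' z) kz kk'.
- move=> z N bz nN; have H := kV z bz.
  have nk : nbhs (k z) [set y | N (k' y)] by apply: ck'; rewrite kk'.
  have [M nM MN] : exists2 M, nbhs (psi z) M &
      forall u : set_type U, M (\val u) -> N (k' (\val (h u))).
    have /ch : nbhs (h (g (set_mk H))) [set v | N (k' (\val v))].
      by rewrite gh; apply/nbhs_set_typeP; exists [set y | N (k' y)].
    by rewrite (psiE _ H) => /nbhs_set_typeP.
  have nU : nbhs (psi z) U.
    by apply: open_nbhs_nbhs; split=> //; rewrite (psiE _ H); exact: set_typeP.
  apply: filterS (filterI nM nU) => y [My Uy].
  exists (k' (\val (h (set_mk Uy)))); first exact: MN.
  have H' : V (k (k' (\val (h (set_mk Uy))))) by rewrite k'k; exact: set_typeP.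
  rewrite (psiE _ H').
  have -> : set_mk H' = h (set_mk Uy) by apply: set_type_inj => /=; rewrite k'k.
  by rewrite hg.
Qed.

(** Only the trace on [box 2] is considered, because psi may fail to be injective beyond it. *)
Lemma chart_countable (X : topologicalType) (psi : R * R -> X) (A : set X) :
  chart psi -> countable A -> countable (box 2 `&` psi @^-1` A).
Proof.
move=> [_ psii _] /countable_injP[f fi]; apply/countable_injP.
exists (f \o psi) => z z' /set_mem[bz Az] /set_mem[bz' Az'] /= ff.
by apply: psii => //; apply: fi => //; exact/mem_set.
Qed.

Lemma setD_box_preimage (X : Type) (psi : R * R -> X) (W : set (R * R)) (A : set X) :
  W `<=` box 2 -> W `\` (box 2 `&` psi @^-1` A) = W `\` (psi @^-1` A).
Proof.
move=> sW; rewrite eqEsubset; split=> z [Wz nz]; split=> //.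
  by move=> Az; apply: nz; split=> //; exact: sW.
by move=> [_ Az]; exact: nz.
Qed.

Lemma dense_setC_countable (X : topologicalType) (A : set X) :
  locally_planar R X -> countable A -> dense (~` A).
Proof.
move=> lpX cA W [x Wx] oW.
have [psi psiC psi0] := locally_planar_chart x lpX.
have [cpsi _ _] := psiC.
have nW : nbhs (0 : R * R) [set z | W (psi z)].
  apply: (cpsi _ box2_0); apply: open_nbhs_nbhs; split=> //.
  by rewrite psi0.
have [||z [[bz Wz] nAz]] := @open_minus_countable _ (box 2 `&` interior [set z | W (psi z)])
    _ _ _ (chart_countable psiC cA).
- by apply: openI; [exact: box_open|exact: open_interior].
- by exists 0; split; [exact: box2_0|].
exists (psi z); split; first exact: (nbhs_singleton Wz).
by move=> Az; exact: nAz.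
Qed.

(** A locally constant P on the complement of A extends to a locally constant [Q] on X: in a chart
    the complement of A is connected, so P is constant there. *)
Lemma connected_setC_countable (X : topologicalType) (A : set X) :
  locally_planar R X -> countable A -> connected [set: X] -> connected (~` A).
Proof.
move=> lpX cA /connected_locally_constantP conX.
apply/connected_locally_constantP => P lcP x y nAx nAy Px.
pose Q (x : X) := \forall z \near x, ~ A z -> P z.
have QP z : ~ A z -> (Q z <-> P z).
  move=> nAz; split=> [/nbhs_singleton|Pz]; first exact.
  by apply: filterS (lcP z nAz) => t Pt nAt; apply/Pt.
have lcQ : locally_constant_on [set: X] Q.
  move=> z _; have [psi psiC psi0] := locally_planar_chart z lpX.
  have [cpsi _ opsi] := psiC.
  have Pbox u v : box 2 u -> box 2 v -> ~ A (psi u) -> ~ A (psi v) ->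
      P (psi u) -> P (psi v).
    move=> bu bv Au Av.
    have := connected_convex_minus_countable (@box_open 2) (@box_convex 2)
      (chart_countable psiC cA).
    rewrite setD_box_preimage // => /connected_locally_constantP.
    move=> /(_ [set z | P (psi z)] _ u v); apply; [|by split|by split].
    move=> t [bt At].
    have : nbhs t [set t' | ~ A (psi t') -> (P (psi t') <-> P (psi t))] :=
      cpsi t bt _ (lcP _ At).
    by apply: filterS => t' Pt' [bt' At']; exact: Pt'.
  (* the value of [Q] at a point of the chart is that of [P] on the chart *)
  have Qbox u v : box 2 u -> box 2 v -> Q (psi u) -> Q (psi v).
    move=> bu bv Qu.
    have /filterI/(_ (opsi u _ bu (nbhs_box bu))) := Qu.
    rewrite nbhsE => -[W [oW Wu] sW].
    have [t [/sW[Pt [u' bu' u't]] At]] :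
        W `&` ~` A !=set0 by apply: (dense_setC_countable lpX cA) => //; exists (psi u).
    apply: filterS (opsi v _ bv (nbhs_box bv)) => s [v' bv' <-] As.
    by apply: (Pbox u') => //; rewrite u't //; exact: Pt.
  rewrite -psi0.
  apply: filterS (opsi 0 _ box2_0 (nbhs_box box2_0)) => _ [v bv <-] _.
  by split; apply: Qbox => //; exact: box2_0.
by apply/QP => //; apply: (conX Q lcQ x y) => //; exact/QP.
Qed.

(** The value (3, 0) lies in the region where the plane functions to be transported are constant, so
    that composing with [phi] extends them by this constant. *)
Lemma chart_inverse (X : topologicalType) (psi : R * R -> X) : chart psi ->
  exists phi : X -> R * R, (forall z, box 2 z -> phi (psi z) = z) /\
    (forall y, ~ (psi @` box 2) y -> phi y = (3, 0)).
Proof.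
move=> [_ psii _].
exists (fun y => xget (3, 0) [set z | box 2 z /\ psi z = y]); split=> [z bz|y ny].
  by case: xgetP => [u _ [bu uz]|/(_ z)[]//]; exact: psii.
by case: xgetP => // u _ [bu uy]; case: ny; exists u.
Qed.

Lemma chart_inverse_continuous (X Y : topologicalType) (psi : R * R -> X)
    (phi : X -> R * R) (f : R * R -> Y) (z : R * R) :
  chart psi -> (forall z, box 2 z -> phi (psi z) = z) -> box 2 z ->
  continuous_at z f -> continuous_at (psi z) (f \o phi).
Proof.
move=> [_ _ opsi] phiP bz cf N /=; rewrite phiP // => nN.
have /= nf : nbhs z (f @^-1` N) := cf _ nN.
have nfb : nbhs z (f @^-1` N `&` box 2) by apply: filterI => //; exact: nbhs_box.
have {}nfb := opsi z _ bz nfb.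
suff : nbhs (psi z) ((f \o phi) @^-1` N) by [].
apply: (nbhs_sub nfb).
by move=> _ [u [fu bu] <-] /=; rewrite phiP.
Qed.

Lemma locally_planar_pull (S X : topologicalType) (q : S -> X) :
  locally_planar R X -> continuous q ->
  (forall s N, nbhs s N -> nbhs (q s) (q @` N)) ->
  (forall s, exists2 N, open N /\ N s &
    forall t u, N t -> N u -> q t = q u -> t = u) ->
  locally_planar R S.
Proof.
move=> lpX cq oq iq s.
have [N [oN Ns] iN] := iq s.
have [psi psiC psi0] := locally_planar_chart (q s) lpX.
have [cpsi _ opsi] := psiC.
have [phi [phiP _]] := chart_inverse psiC.
have oB : open (psi @` box 2).
  rewrite openE => _ [z bz <-]; exact: opsi (nbhs_box bz).
have [||||oV homV] := @open_embedding S (R * R)%type (phi \o q)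
    (N `&` q @^-1` (psi @` box 2)) _ _ erefl.
- by apply: openI => //; apply: open_comp => // t _; exact: cq.
- move=> t [_ [z bz zt]].
  apply: (@continuous_comp _ _ _ q phi); first exact: cq.
  rewrite -zt; apply: (@chart_inverse_continuous _ _ _ phi id) => //.
- move=> t u [Nt [z bz zt]] [Nu [z' bz' zu]] /=.
  rewrite -zt -zu !phiP // => zz; apply: iN => //; by rewrite -zt -zu zz.
- move=> t [_ [z bz zt]] M nM /=; rewrite -zt phiP //.
  have nq : nbhs (psi z) (q @` M) by rewrite zt; exact: oq.
  have : nbhs z (psi @^-1` (q @` M)) := cpsi z bz _ nq.
  move/filterI/(_ (nbhs_box bz)); apply: filterS => u [[m Mm mu] bu].
  by exists m => //=; rewrite mu phiP.
exists (N `&` q @^-1` (psi @` box 2)), ((phi \o q) @` (N `&` q @^-1` (psi @` box 2))).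
split=> //.
- by apply: openI => //; apply: open_comp => // t _; exact: cq.
- by split=> //; exists 0 => //; exact: box2_0.
- by have [h [homh _]] := homV; exists h.
Qed.

(** The image of the closed unit square is compact, hence closed in the Hausdorff space X. A point
    outside the chart has a neighbourhood that misses it, and there f \o phi is the constant c. *)
Lemma chart_extension_continuous (X Y : topologicalType) (psi : R * R -> X)
    (phi : X -> R * R) (f : R * R -> Y) (c : Y) (y : X) :
  hausdorff_space X -> chart psi ->
  (forall z, box 2 z -> phi (psi z) = z) ->
  (forall y, ~ (psi @` box 2) y -> phi y = (3, 0)) ->
  (forall z, 1 < `|z.1| \/ 1 < `|z.2| -> f z = c) ->
  ~ (psi @` box 2) y -> continuous_at y (f \o phi).
Proof.
move=> hX psiC phiP phi3 fc ny.
have [cpsi _ _] := psiC.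
pose K : set (R * R) := `[-1, 1]%classic `*` `[-1, 1]%classic.
have Kbox : K `<=` box 2.
  move=> [a b] [] /=; rewrite !in_itv /= /box /= !ltr_norml.
  by move=> /andP[? ?] /andP[? ?]; split; apply/andP; split; lra.
have cK : closed (psi @` K).
  apply: compact_closed => //; apply: continuous_compact.
    apply: continuous_in_subspaceT => z /set_mem /Kbox; exact: cpsi.
  by apply: compact_setX; exact: segment_compact.
have f3 : f (3, 0) = c by apply: fc; left; rewrite /= gtr0_norm; lra.
have nK : nbhs y (~` (psi @` K)).
  apply: open_nbhs_nbhs; split; first exact: closed_openC.
  by move=> [z /Kbox bz zy]; apply: ny; exists z.
move=> N /=; rewrite phi3 // f3 => nN.
suff : nbhs y ((f \o phi) @^-1` N) by [].
apply: (nbhs_sub nK).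
move=> t nt /=; have [[z bz zt]|nb] := pselect ((psi @` box 2) t); last first.
  by rewrite phi3 // f3; exact: nbhs_singleton.
rewrite -zt phiP // fc; first exact: nbhs_singleton.
apply: contrapT => nz; apply: nt; exists z => //.
move/not_orP: nz => [/negP + /negP]; rewrite -!leNgt !ler_norml => h1 h2.
by split; rewrite /= in_itv.
Qed.

End Charts.

(** * The double cover of the square roots of a function *)

Section RootCover.
Variables (R : realType) (X : topologicalType) (f : X -> R * R) (X0 : set X).

(* The pull-back of the squaring map of C^* along [f], restricted to [X0]. *)
Definition root_cover : topologicalType :=
  set_type [set e : X * (R * R) | X0 e.1 /\ sq e.2 = f e.1].

Definition base (e : root_cover) : X := (\val e).1.
Definition root (e : root_cover) : R * R := (\val e).2.

Hypothesis cf : continuous_on X0 f.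
Hypothesis f0 : forall x, X0 x -> f x != 0.

Lemma base_in e : X0 (base e).
Proof. by have [] := set_typeP e. Qed.

Lemma rootP e : sq (root e) = f (base e).
Proof. by have [] := set_typeP e. Qed.

Lemma root_neq0 e : root e != 0.
Proof. by rewrite -sq_eq0 rootP f0 //; exact: base_in. Qed.

Lemma root_cover_eq e e' : base e = base e' -> root e = root e' -> e = e'.
Proof.
move=> b r; apply: set_type_inj.
by rewrite [LHS]surjective_pairing [RHS]surjective_pairing; congr pair.
Qed.

Lemma root_cover_point x w : X0 x -> sq w = f x ->
  exists e, base e = x /\ root e = w.
Proof.
move=> xX wf.
by exists (set_mk (conj xX wf : [set e : X * (R * R) | X0 e.1 /\ sq e.2 = f e.1] (x, w))).
Qed.

Lemma base_continuous : continuous base.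
Proof.
move=> e; apply: (@continuous_comp _ _ _ (fun e : root_cover => \val e) fst).
  exact: continuous_val.
exact: cvg_fst.
Qed.

Lemma root_continuous : continuous root.
Proof.
move=> e; apply: (@continuous_comp _ _ _ (fun e : root_cover => \val e) snd).
  exact: continuous_val.
exact: cvg_snd.
Qed.

Lemma root_cover_continuous (Y : topologicalType) (g : Y -> root_cover) y :
  continuous_at y (base \o g) -> continuous_at y (root \o g) ->
  continuous_at y g.
Proof.
move=> cb cr; apply: continuous_into.
suff -> : (fun z => \val (g z)) = (fun z => ((base \o g) z, (root \o g) z)).
  exact: continuous_pair.
by apply/funext => z; rewrite [LHS]surjective_pairing.
Qed.

Definition flip (e : root_cover) : root_cover :=
  set_mk (conj (base_in e) (etrans (sqN (root e)) (rootP e))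
    : [set e : X * (R * R) | X0 e.1 /\ sq e.2 = f e.1] (base e, - root e)).

Lemma base_flip e : base (flip e) = base e. Proof. by []. Qed.

Lemma root_flip e : root (flip e) = - root e. Proof. by []. Qed.

Lemma flipK : involutive flip.
Proof. by move=> e; apply: root_cover_eq; rewrite // !root_flip opprK. Qed.

Lemma flip_continuous : continuous flip.
Proof.
move=> e; apply: root_cover_continuous; first exact: base_continuous.
apply: (@continuous_comp _ _ _ root (fun w : R * R => - w)); first exact: root_continuous.
exact: opp_continuous.
Qed.

Lemma same_base e e' : base e = base e' -> e' = e \/ e' = flip e.
Proof.
move=> b; have /sq_inj[r|r] : sq (root e') = sq (root e) by rewrite !rootP b.
  by left; exact: root_cover_eq.
by right; apply: root_cover_eq.
Qed.

(** Openness is stated relative to X0, because the complement of the dense set A is not open. It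
    comes from the openness of squaring at non-zero points. *)
Lemma base_open e N : nbhs e N ->
  \forall y \near base e, X0 y -> exists2 e', N e' & base e' = y.
Proof.
move=> /nbhs_set_typeP[M [[M1 M2] /= [nM1 nM2] sM] MN].
have := sq_open (root_neq0 e) nM2; rewrite rootP => nf.
have ncf := cf (base_in e) nf.
apply: filterS (filterI nM1 ncf) => y [M1y ny] yX.
have [r M2r ry] := ny yX.
have [e' [be re]] := root_cover_point yX ry.
exists e' => //; apply: MN; apply: sM; split=> /=.
  by rewrite -/(base e') be.
by rewrite -/(root e') re.
Qed.

Lemma near_dot e : nbhs e [set e' | 0 < dot (root e') (root e)].
Proof.
apply: (near_gt0 (g := fun e' => dot (root e') (root e))).
  apply: (@continuous_comp _ _ _ root (fun w => dot w (root e))).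
    exact: root_continuous.
  exact: dot_continuous.
by rewrite dot_gt0 root_neq0.
Qed.

Lemma base_separated e e' w : base e = base e' ->
  0 < dot (root e) w -> 0 < dot (root e') w -> e = e'.
Proof.
move=> /same_base[-> //|->] h; rewrite root_flip dotN oppr_gt0 => h'.
by have := lt_trans h h'; rewrite ltxx.
Qed.

Definition root_proj (e : root_cover) : set_type X0 := set_mk (base_in e).

Lemma root_proj_continuous : continuous root_proj.
Proof. by move=> e; apply: continuous_into; exact: base_continuous. Qed.

Lemma root_proj_open e N : nbhs e N -> nbhs (root_proj e) (root_proj @` N).
Proof.
move=> nN; apply/nbhs_set_typeP; exists [set y | X0 y -> exists2 e', N e' & base e' = y].
  exact: base_open nN.
by move=> y /(_ (set_typeP y))[e' Ne' be]; exists e' => //; exact: set_type_inj.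
Qed.

(** Where f stays within a right angle of f(b), its roots stay within half a right angle of w0 or
    -w0, the roots of f(b). The sign of the inner product with w0 then labels the two sheets. *)
Lemma root_proj_evenly_covered (b : set_type X0) :
  exists U, [/\ open U, U b & evenly_covered root_proj U].
Proof.
pose g (b' : set_type X0) := f (\val b').
have cg : continuous g.
  move=> b' N nN; apply/nbhs_set_typeP.
  exists [set y | X0 y -> N (f y)]; first exact: (cf (set_typeP b') nN).
  by move=> y; apply; exact: set_typeP.
pose U := [set b' | 0 < dot (g b') (g b)].
have oU : open U.
  apply: open_gt0 => b'; apply: (@continuous_comp _ _ _ g (fun w => dot w (g b))).
    exact: cg.
  exact: dot_continuous.
have Ub : U b.
  by rewrite /U /= dot_gt0 f0 //; exact: set_typeP.
exists U; split=> //.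
have [w0 w0b] := sq_surj (g b).
pose V (s : R) := [set e | U (root_proj e) /\ 0 < dot (root e) (s *: w0)].
have oV s : open (V s).
  apply: openI; first by apply: open_comp => // e _; exact: root_proj_continuous.
  apply: open_gt0 => e.
  apply: (@continuous_comp _ _ _ root (fun w => dot w (s *: w0))).
    exact: root_continuous.
  exact: dot_continuous.
have dotZ s z : dot z (s *: w0) = s * dot z w0.
  by rewrite /dot /= /GRing.scale /=; ring.
have Vex e : U (root_proj e) -> dot (root e) w0 != 0.
  rewrite /U /= /g /= -/(g b) -rootP -w0b => h; apply: contraTneq h => d0.
  (* Up to the moduli, cos 2t = cos^2 t - sin^2 t for the angle t between the root and w0. *)
  have -> : dot (sq (root e)) (sq w0) =
    dot (root e) w0 ^+ 2 - ((root e).1 * w0.2 - (root e).2 * w0.1) ^+ 2.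
    by rewrite /dot /sq /=; ring.
  by rewrite d0 expr0n /= sub0r -leNgt oppr_le0 sqr_ge0.
have V1 e : V 1 e -> V (-1) e -> False.
  by move=> [_ +] [_]; rewrite !dotZ; lra.
exists [set V 1; V (-1)]; split.
- by move=> _ [->|->].
- move=> _ _ [->|->] [->|->] // [e [? ?]]; by case: (@V1 e).
- rewrite eqEsubset; split=> [e Ue|e [_ [->|->] []//]].
  have := Vex e Ue; rewrite neq_lt => /orP[d|d].
    by exists (V (-1)); [right|split=> //; rewrite dotZ mulN1r oppr_gt0].
  by exists (V 1); [left|split=> //; rewrite dotZ mul1r].
have homV s : s ^+ 2 = 1 -> exists h : set_type (V s) -> set_type U,
    homeomorphism h /\ forall v, \val (h v) = root_proj (\val v).
  move=> s2.
  have s0 : s != 0 by rewrite -sqrf_eq0 s2 oner_eq0.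
  have imV : root_proj @` V s = U.
    rewrite eqEsubset; split=> [_ [e [Ue _] <-] //|b' Ub'].
    have [r rb'] := sq_surj (g b').
    have [e [eb er]] := root_cover_point (set_typeP b') rb'.
    have peb : root_proj e = b' by exact: set_type_inj.
    have ds : s * dot (root e) w0 != 0 by rewrite mulf_neq0 // Vex // peb.
    move: ds; rewrite neq_lt => /orP[d|d].
      exists (flip e); last by apply: set_type_inj; rewrite -peb.
      split; last by rewrite dotZ root_flip dotN mulrN oppr_gt0.
      suff -> : root_proj (flip e) = b' by [].
      by apply: set_type_inj; rewrite -peb.
    by exists e => //; split; [rewrite peb|rewrite dotZ].
  have [|||_ //] := @open_embedding _ _ root_proj (V s) U (oV s) imV.
  - by move=> e _; exact: root_proj_continuous.
  - move=> e e' [_ d] [_ d'] /(congr1 val) ee'.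
    exact: (base_separated ee' d d').
  - by move=> e _ N; exact: root_proj_open.
by move=> _ [->|->]; apply: homV; rewrite ?expr1n // sqrrN expr1n.
Qed.

Lemma root_proj_regular : regular_covering root_proj.
Proof.
split; first split.
- exact: root_proj_continuous.
- rewrite -subTset => b _; have [r rb] := sq_surj (f (\val b)).
  have [e [eb er]] := root_cover_point (set_typeP b) rb.
  by exists e => //; exact: set_type_inj.
- exact: root_proj_evenly_covered.
move=> x y /(congr1 val) /= /same_base[->|->].
  exists id => //; split=> //; split; first by move=> z; exact: cvg_id.
  by exists id; split=> // z; exact: cvg_id.
exists flip => //; split; last by move=> z; exact: set_type_inj.
split; first exact: flip_continuous.
by exists flip; split; [exact: flip_continuous|exact: flipK|exact: flipK].
Qed.

(** A locally constant P that is not constant holds at exactly one point of each fibre, and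
    selecting this point gives a continuous root of f. *)
Lemma root_cover_connected :
  connected X0 ->
  ~ (exists w : X -> R * R,
      continuous_on X0 w /\ forall x, X0 x -> sq (w x) = f x) ->
  connected [set: root_cover].
Proof.
move=> /connected_locally_constantP conX noroot.
apply/connected_locally_constantP => P lcP e1 e2 _ _ Pe1; apply: contrapT => nPe2.
have lcP' e : nbhs e [set e' | P e' <-> P e].
  by apply: filterS (lcP e I) => e' /(_ I).
(* By symmetry of Q the choice of a point in the fibre is immaterial, so this is a locally constant
   condition on X0. It is applied to conjunction and to disjunction. *)
have lc (Q : Prop -> Prop -> Prop) : (forall a b, Q a b -> Q b a) ->
    (forall a a' b b', (a <-> a') -> (b <-> b') -> Q a b -> Q a' b') ->
    forall e e', Q (P e) (P (flip e)) -> Q (P e') (P (flip e')).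
  move=> Qs Qe e e' Qee.
  pose T := [set x | forall u, base u = x -> Q (P u) (P (flip u))].
  suff Te' : T (base e') by exact: Te'.
  apply: (conX T _ (base e)); try exact: base_in; last first.
    by move=> u /esym/same_base[->|->] //; rewrite flipK; exact: Qs.
  move=> x xX.
  have [r rx] := sq_surj (f x); have [t [tx tr]] := root_cover_point xX rx.
  have ntf : nbhs t [set t' | P (flip t') <-> P (flip t)] :=
    @flip_continuous t _ (lcP' (flip t)).
  have nt : nbhs t ([set t' | P t' <-> P t] `&` [set t' | P (flip t') <-> P (flip t)]).
    exact: filterI.
  have := base_open nt; rewrite tx.
  apply: filterS => y ny yX; have [t' [Pt Pft] ty] := ny yX; rewrite /= in Pft.
  split=> Ty u.
    rewrite -tx => /esym/same_base[->|->].
      by apply: (Qe (P t') _ (P (flip t'))) => //; exact: Ty.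
    rewrite flipK; apply: Qs.
    by apply: (Qe (P t') _ (P (flip t'))) => //; exact: Ty.
  have Qt' : Q (P t') (P (flip t')).
    by apply: (Qe (P t) _ (P (flip t))); [exact: iff_sym|exact: iff_sym|exact: Ty].
  by rewrite -ty => /esym/same_base[->|->] //; rewrite flipK; exact: Qs.
have nPflip e : P e -> ~ P (flip e).
  move=> Pe Pfe; apply: nPe2.
  by have [] := lc (fun a b => a /\ b) _ _ e e2; [tauto|tauto|split|].
have Pflip e : P e \/ P (flip e).
  apply: (lc or _ _ e1); [tauto|tauto|by left].
have /choice[w wP] x : exists w, X0 x -> exists e, [/\ P e, base e = x & root e = w].
  have [xX|nxX] := pselect (X0 x); last by exists 0.
  have [r rx] := sq_surj (f x); have [t [tx tr]] := root_cover_point xX rx.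
  have [Pt|Pt] := Pflip t; first by exists (root t) => _; exists t.
  by exists (root (flip t)) => _; exists (flip t).
apply: noroot; exists w; split=> [x xX N nN|x xX]; last first.
  by have [e [_ <- <-]] := wP x xX; rewrite rootP.
have [e [Pe ex er]] := wP x xX.
have nNe : nbhs e [set e' | N (root e')] by apply: root_continuous; rewrite er.
have ne : nbhs e ([set e' | N (root e')] `&` [set e' | P e' <-> P e]) by exact: filterI.
have := base_open ne; rewrite ex.
apply: filterS => y ny yX; have [e' [Ne' Pe'] ey] := ny yX.
have [t [Pt ty <-]] := wP y yX.
have /same_base[->//|tf] : base e' = base t by rewrite ey ty.
by case: (@nPflip e'); [exact/Pe'|rewrite -tf].
Qed.

(** * Root covers over an open set *)

Hypothesis oX0 : open X0.

Lemma base_nbhs e N : nbhs e N -> nbhs (base e) (base @` N).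
Proof.
move=> nN.
have nX : nbhs (base e) X0.
  by apply: open_nbhs_nbhs; split=> //; exact: base_in.
by apply: filterS (filterI nX (base_open nN)) => y [yX /(_ yX)].
Qed.

Lemma root_cover_hausdorff : hausdorff_space X -> hausdorff_space root_cover.
Proof.
move=> hX e e' ee'.
apply: root_cover_eq.
  apply: hX => A B /base_continuous nA /base_continuous nB.
  by have [t [At Bt]] := ee' _ _ nA nB; exists (base t).
apply: (@norm_hausdorff _ (R * R)%type) => A B /root_continuous nA /root_continuous nB.
by have [t [At Bt]] := ee' _ _ nA nB; exists (root t).
Qed.

Lemma root_cover_locally_planar : locally_planar R X -> locally_planar R root_cover.
Proof.
move=> lpX; apply: (locally_planar_pull lpX base_continuous base_nbhs) => e.
exists [set e' | 0 < dot (root e') (root e)]; last first.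
  by move=> t u dt du tu; exact: (base_separated tu dt du).
split; last by rewrite /= dot_gt0 root_neq0.
apply: open_gt0 => e'.
apply: (@continuous_comp _ _ _ root (fun w => dot w (root e))).
  exact: root_continuous.
exact: dot_continuous.
Qed.

Lemma root_cover_dense (A : set X) : dense A -> dense [set e | A (base e)].
Proof.
move=> dA W [e We] oW.
have := base_nbhs (open_nbhs_nbhs (conj oW We)); rewrite nbhsE => -[V [oV Ve] VW].
have [x [/VW[e' We' ex] Ax]] := dA V (ex_intro _ _ Ve) oV.
by exists e'; split=> //=; rewrite ex.
Qed.

Lemma root_cover_countable (A : set X) : countable A -> countable [set e | A (base e)].
Proof.
move=> cA.
apply: (@sub_countable _ _ _ (\bigcup_(x in A) [set e | base e = x])).
  by apply: subset_card_le => e Ae; exists (base e).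
apply: bigcup_countable => // x _.
have [[e ex]|ne] := pselect (exists e, base e = x).
  apply: finite_set_countable; apply: (@sub_finite_set _ _ [set e; flip e]).
    by move=> e' /=; rewrite -ex => /esym/same_base.
  exact: finite_set2.
suff -> : [set e | base e = x] = set0 by exact: countable0.
by rewrite -subset0 => e ex; apply: ne; exists e.
Qed.

(** A fibre has two points; the two members of F around them cover all that lies over a small W,
    where [dot] tells the sheets apart. *)
Lemma root_cover_paracompact (d : X -> R) :
  paracompact X -> continuous d -> X0 = [set x | 0 < d x] ->
  paracompact root_cover.
Proof.
move=> pX cd X0E.
apply: (paracompact_pull pX base_continuous cd) => [e|F oF covF x dx].
  by have := base_in e; rewrite X0E.
have xX : X0 x by rewrite X0E.
have [r rx] := sq_surj (f x); have [t [tx tr]] := root_cover_point xX rx.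
have [U1 FU1 U1t] : (\bigcup_(U in F) U) t by rewrite covF.
have [U2 FU2 U2t] : (\bigcup_(U in F) U) (flip t) by rewrite covF.
have nbase (u : root_cover) U : F U -> U u ->
    nbhs (base u) (base @` (U `&` [set e' | 0 < dot (root e') (root u)])).
  move=> FU Uu; apply: base_nbhs; apply: filterI; last exact: near_dot.
  by apply: open_nbhs_nbhs; split=> //; exact: oF.
have n1 := nbase _ _ FU1 U1t; have n2 := nbase _ _ FU2 U2t.
rewrite base_flip in n2; rewrite tx in n1 n2.
have : nbhs x (base @` (U1 `&` [set e' | 0 < dot (root e') (root t)]) `&`
    base @` (U2 `&` [set e' | 0 < dot (root e') (root (flip t))])) by exact: filterI.
rewrite nbhsE => -[W [oW Wx] sW].
exists W, [set U1; U2]; split=> //.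
- by move=> _ [->|->].
move=> e /sW[[e1 [U1e1 d1] b1] [e2 [U2e2 d2] b2]].
have e12 : e2 = flip e1.
  have /same_base[e21|//] : base e1 = base e2 by rewrite b1 b2.
  move: d2; rewrite e21 /= root_flip dotNr oppr_gt0 => d2.
  by have := lt_trans d1 d2; rewrite ltxx.
have /same_base[->|->] := b1; first by exists U1 => //; left.
by exists U2; [right|rewrite -e12].
Qed.

End RootCover.

(** Over { d > 0 }, which contains the complement of A, f is still continuous and non-zero. This
    provides the ambient surface S, while the absence of a root makes the cover connected. *)
Lemma root_cover_perforated (R : realType) (X : topologicalType)
    (f : X -> R * R) (d : X -> R) (A : set X) :
  connected_surface R X -> countable A -> dense A -> continuous d ->
  (forall x, 0 < d x -> continuous_at x f) ->
  (forall x, 0 < d x -> f x != 0) ->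
  (forall x, ~ A x -> 0 < d x) ->
  ~ (exists w : X -> R * R,
      continuous_on (~` A) w /\ forall x, ~ A x -> sq (w x) = f x) ->
  connected_regular_covering (@root_proj R X f (~` A)) /\
  perforated_surface R (root_cover f (~` A)).
Proof.
move=> [[hX pX lpX] [x0 _] conX] cA dA cd cf f0 dA0 noroot.
pose X0 := [set x | 0 < d x].
have oX0 : open X0 by apply: open_gt0 => x; exact: cd.
have cfA : continuous_on (~` A) f.
  by apply: continuous_at_on => x /dA0; exact: cf.
have cfX : continuous_on X0 f by exact: continuous_at_on.
have f0A x : (~` A) x -> f x != 0 by move=> /dA0; exact: f0.
have conE : connected [set: root_cover f (~` A)].
  apply: root_cover_connected => //; exact: connected_setC_countable.
have dcA : dense (~` A) := dense_setC_countable lpX cA.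
have neE : [set: root_cover f (~` A)] !=set0.
  have [x [_ Ax]] := dcA setT (ex_intro _ x0 I) openT.
  have [r rx] := sq_surj (f x); have [t _] := root_cover_point Ax rx.
  by exists t.
split; first by split=> //; exact: root_proj_regular.
pose S := root_cover f X0.
pose B := [set s : S | A (base s)].
have /choice[i iP] (e : root_cover f (~` A)) : exists s : S, base s = base e /\ root s = root e.
  apply: root_cover_point; last exact: rootP.
  by apply: dA0; exact: (@base_in _ _ _ (~` A) e).
have iB e : (~` B) (i e).
  by rewrite /B /=; have [-> _] := iP e; exact: (@base_in _ _ _ (~` A) e).
have ci : continuous i.
  move=> e; apply: root_cover_continuous.
    rewrite (_ : _ \o _ = @base R X f (~` A)); first exact: base_continuous.
    by apply/funext => t /=; have [] := iP t.
  rewrite (_ : _ \o _ = @root R X f (~` A)); first exact: root_continuous.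
  by apply/funext => t /=; have [] := iP t.
have iex (s : S) : ~ B s -> exists e, i e = s.
  move=> Bs; have [e [be re]] := root_cover_point (Bs : (~` A) (base s)) (rootP s).
  by exists e; have [b r] := iP e; apply: root_cover_eq; rewrite ?b ?r.
exists S, B; split.
- split; first split.
  + exact: root_cover_hausdorff.
  + exact: (root_cover_paracompact cfX f0 oX0 pX cd).
  + exact: root_cover_locally_planar.
  + by have [e _] := neE; exists (i e).
  + have dB : dense (~` B) by exact: (root_cover_dense cfX f0 oX0 dcA).
    (* S inherits connectedness from the cover, which [i] maps onto a dense subset. *)
    apply/connected_locally_constantP => P lcP x y _ _ Px.
    have near_i s : exists e, P (i e) <-> P s.
      have : nbhs s [set t | [set: S] t -> (P t <-> P s)] := lcP s I.
      rewrite nbhsE => -[W [oW Ws] sW].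
      have [t [/sW /(_ I) Pt /iex[e et]]] := dB W (ex_intro _ _ Ws) oW.
      by exists e; rewrite et.
    have [ex exP] := near_i x; have [ey eyP] := near_i y.
    apply/eyP; move/exP: Px.
    move/connected_locally_constantP: conE => /(_ [set e | P (i e)]); apply=> // e _.
    have : nbhs e [set e' | [set: S] (i e') -> (P (i e') <-> P (i e))] :=
      ci e _ (lcP (i e) I).
    by apply: filterS => e' /(_ I).
- exact: root_cover_countable.
- exact: (root_cover_dense cfX f0 oX0).
pose h e := set_mk (iB e); exists h.
split; first by move=> e; apply: continuous_into; exact: ci.
have /choice[k kP] (s : set_type (~` B)) : exists e, i e = \val s.
  exact: iex (set_typeP s).
have ii e e' : i e = i e' -> e = e'.
  have [b r] := iP e; have [b' r'] := iP e' => ee'.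
  by apply: root_cover_eq; rewrite -?b -?b' -?r -?r' ee'.
exists k; split.
- move=> s; apply: root_cover_continuous.
    rewrite (_ : _ \o _ = @base R X f X0 \o (fun s : set_type (~` B) => \val s)).
      by apply: continuous_comp; [exact: continuous_val|exact: base_continuous].
    by apply/funext => t /=; rewrite -kP; have [] := iP (k t).
  rewrite (_ : _ \o _ = @root R X f X0 \o (fun s : set_type (~` B) => \val s)).
    by apply: continuous_comp; [exact: continuous_val|exact: root_continuous].
  by apply/funext => t /=; rewrite -kP; have [] := iP (k t).
- by move=> e; apply: ii; rewrite kP.
- by move=> s; apply: set_type_inj; rewrite /= kP.
Qed.

(** * Functions with prescribed dipoles *)

Section DipoleSum.
Variable R : realType.
Implicit Types (z u m e : R * R).

(* [similar m e] and [unsimilar m e] are u |-> m + e u and its inverse, in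
   complex notation. *)
Definition similar m e u :=
  (m.1 + (e.1 * u.1 - e.2 * u.2), m.2 + (e.1 * u.2 + e.2 * u.1)).

Definition unsimilar m e z :=
  ((e.1 * (z.1 - m.1) + e.2 * (z.2 - m.2)) / nsq e,
   (e.1 * (z.2 - m.2) - e.2 * (z.1 - m.1)) / nsq e).

Lemma similarK m e : e != 0 -> cancel (similar m e) (unsimilar m e).
Proof.
rewrite -nsq_eq0 /nsq => e0 [x y].
by rewrite /similar /unsimilar /nsq /=; congr pair; field.
Qed.

Lemma unsimilarK m e : e != 0 -> cancel (unsimilar m e) (similar m e).
Proof.
rewrite -nsq_eq0 /nsq => e0 [x y].
by rewrite /similar /unsimilar /nsq /=; congr pair; field.
Qed.

Lemma similar_continuous m e u : continuous_at u (similar m e).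
Proof. by rewrite /similar; continuity. Qed.

Lemma unsimilar_continuous m e z : continuous_at z (unsimilar m e).
Proof. by rewrite /unsimilar; continuity. Qed.

Lemma nsq_similar m e u : nsq (similar m e u - m) = nsq e * nsq u.
Proof. by rewrite /nsq /similar /=; ring. Qed.

(* Pairwise disjoint sets, locally finite away from the origin. *)
Definition strip n : set (R * R) :=
  [set z | n.+1%:R * z.1 < 1 < n.+2%:R * z.1 /\ n.+1%:R * `|z.2| < 1].

Lemma strip_gt0 n z : strip n z -> 0 < z.1.
Proof.
move=> [/andP[_ h] _]; rewrite -(@pmulr_rgt0 _ n.+2%:R) //.
exact: lt_trans h.
Qed.

Lemma strip_disjoint i j z : strip i z -> strip j z -> i = j.
Proof.
have le k l : strip k z -> strip l z -> (l <= k)%N.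
  move=> sk [/andP[+ _] _]; have z0 := strip_gt0 sk; case: sk => /andP[_ h] _.
  move=> h'; have := lt_trans h' h; rewrite ltr_pM2r // ltr_nat.
  by rewrite !ltnS.
by move=> si sj; apply/eqP; rewrite eqn_leq !le.
Qed.

(** Bounds the index of a strip through z by 2 / |z|^2, so that few strips come near a point other
    than the origin. *)
Lemma strip_nsq n z : strip n z -> n.+1%:R * nsq z < 2.
Proof.
move=> sz; have z0 := strip_gt0 sz; case: sz => /andP[h1 _] h2.
have n1 : 1 <= n.+1%:R :> R by rewrite ler1n.
have := normr_ge0 z.2; rewrite /nsq -(real_normK (num_real z.2)).
set y := `|z.2| in h2 *; move=> y0.
have : z.1 < 1 by nra.
have : y < 1 by nra.
by move=> *; nra.
Qed.

Lemma strip_box n z : strip n z -> `|z.1| < 1 /\ `|z.2| < 1.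
Proof.
move=> sz; have z0 := strip_gt0 sz; case: sz => /andP[h1 _] h2.
have n1 : 1 <= n.+1%:R :> R by rewrite ler1n.
by have := normr_ge0 z.2; rewrite (gtr0_norm z0) => y0; split; nra.
Qed.

(** Density gives two close points b, c of D near the middle of the strip; m is their midpoint and e
    half their difference, so that -1 and 1 go to b and c. Taking c to the right of b makes e
    non-zero. *)
Lemma strip_disc (D : set (R * R)) n :
  (forall W, open W -> W !=set0 -> W `<=` box 1 -> W `&` D !=set0) ->
  exists m e, [/\ e != 0, D (similar m e (1, 0)), D (similar m e (-1, 0))
    & forall u, nsq u < 2 -> strip n (similar m e u)].
Proof.
move=> dD.
pose p : R := n.+2%:R^-1; pose q : R := n.+1%:R^-1.
have p0 : 0 < p by rewrite invr_gt0.
have pq : p < q by rewrite ltf_pV2 ?posrE // ltr_nat.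
have q1 : q <= 1 by rewrite invf_le1 // ler1n.
pose t := (p + q) / 2; pose r := (q - p) / 2.
have pick (x : R) : t - r / 4 < x < t + r / 4 ->
    exists z, [/\ D z, x < z.1 < t + r / 4 & `|z.2| < r / 4].
  move=> /andP[x1 x2].
  pose W := [set z : R * R | 0 < z.1 - x] `&` [set z | 0 < t + r / 4 - z.1]
    `&` ([set z | 0 < r / 4 - z.2] `&` [set z | 0 < r / 4 + z.2]).
  have [|||z [[[/= h1 h2] [h3 h4]] Dz]] := dD W.
  - by do ! apply: openI; apply: open_gt0 => z; continuity.
  - exists ((x + (t + r / 4)) / 2, 0); rewrite /W /= /t /r in x1 x2 *.
    by split; split; lra.
  - move=> z [[/= h1 h2] [h3 h4]]; rewrite /t /r in x1 x2 h1 h2 h3 h4 *.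
    by split; rewrite ltr_norml; apply/andP; split; lra.
  exists z; split=> //; first by apply/andP; split; lra.
  by rewrite ltr_norml; apply/andP; split; lra.
have [b [Db /andP[b1 b2] b3]] : exists z, [/\ D z, t - r / 8 < z.1 < t + r / 4 & `|z.2| < r / 4].
  by apply: pick; rewrite /t /r; apply/andP; split; lra.
have [c [Dc /andP[c1 c2] c3]] : exists z, [/\ D z, b.1 < z.1 < t + r / 4 & `|z.2| < r / 4].
  by apply: pick; rewrite /t /r in b1 b2 *; apply/andP; split; lra.
pose m := ((b.1 + c.1) / 2, (b.2 + c.2) / 2).
pose e := ((c.1 - b.1) / 2, (c.2 - b.2) / 2).
exists m, e; split.
- by apply: contraTneq c1 => /(congr1 fst) /= e0; rewrite -leNgt; lra.
- suff -> : similar m e (1, 0) = c by [].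
  by rewrite [c]surjective_pairing /similar /m /e /=; congr pair; field.
- suff -> : similar m e (-1, 0) = b by [].
  by rewrite [b]surjective_pairing /similar /m /e /=; congr pair; field.
move=> u u2; set z := similar m e u.
have zm : nsq (z - m) < (r / 2) ^+ 2.
  rewrite nsq_similar.
  (* Both coordinates of e are at most r / 4 in absolute value. Hence the disc has its image within
     r / 2 of m, whose coordinates differ from those of (t, 0) by at most r / 4; here r is half the
     width of the strip. *)
  have ne : nsq e <= r ^+ 2 / 8.
    move: b3 c3; rewrite !ltr_norml => /andP[? ?] /andP[? ?].
    have h (a : R) : - (r / 4) <= a <= r / 4 -> a ^+ 2 <= (r / 4) ^+ 2.
      by move=> /andP[? ?]; nra.
    have h1 : e.1 ^+ 2 <= (r / 4) ^+ 2.
      by apply: h; rewrite /e /t /r /= in b1 b2 c1 c2 *; apply/andP; split; lra.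
    have h2 : e.2 ^+ 2 <= (r / 4) ^+ 2.
      by apply: h; rewrite /e /=; apply/andP; split; lra.
    by rewrite /nsq; lra.
  apply: (@le_lt_trans _ _ (r ^+ 2 / 8 * nsq u)).
    by rewrite ler_wpM2r ?nsq_ge0.
  have r2 : 0 < r ^+ 2 by rewrite exprn_gt0 // /r; lra.
  have -> : (r / 2) ^+ 2 = r ^+ 2 / 8 * 2 by field.
  by rewrite ltr_pM2l // divr_gt0.
clearbody z.
have r0 : 0 < r by rewrite /r; lra.
have [z1 z2] : `|z.1 - m.1| < r / 2 /\ `|z.2 - m.2| < r / 2.
  have r20 : 0 < r / 2 by lra.
  split; first exact: (ltr_norm_sqrD r20 zm).
  by apply: (@ltr_norm_sqrD _ _ (z.1 - m.1)) => //; rewrite addrC.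
move: z1 z2 b3 c3; rewrite !ltr_norml /m /= => /andP[? ?] /andP[? ?] /andP[? ?] /andP[? ?].
have tE : p + q = 2 * t by rewrite /t; field.
have rE : q - p = 2 * r by rewrite /r; field.
have z1p : p < z.1 by lra.
have z1q : z.1 < q by lra.
have z2q : `|z.2| < q by rewrite ltr_norml; apply/andP; split; lra.
have n1 : 0 < n.+1%:R :> R by [].
have n2 : 0 < n.+2%:R :> R by [].
split; last by rewrite mulrC -ltr_pdivlMr // mul1r.
apply/andP; split; first by rewrite mulrC -ltr_pdivlMr // mul1r.
by rewrite mulrC -ltr_pdivrMr // mul1r.
Qed.

Section Sum.
Variables (m e : nat -> R * R) (act : nat -> bool).
Hypothesis e0 : forall n, e n != 0.
Hypothesis strip_me : forall n u, nsq u < 2 -> strip n (similar (m n) (e n) u).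

Definition summand n z :=
  if act n then dipole (unsimilar (m n) (e n) z) else (1, 0).

Lemma summand_continuous n z : continuous_at z (summand n).
Proof.
rewrite /summand; case: (act n); last exact: cvg_cst.
apply: (@continuous_comp _ _ _ (unsimilar (m n) (e n)) (@dipole R)).
  exact: unsimilar_continuous.
exact: dipole_continuous.
Qed.

Lemma summand_off n z : ~ strip n z -> summand n z = (1, 0).
Proof.
move=> nz; rewrite /summand; case: (act n) => //; apply: dipole_far.
rewrite leNgt; apply/negP => /(@strip_me n).
by rewrite unsimilarK //; exact: nz.
Qed.

(** The operation sending (a, b), (c, d) to (a c, b + d) has the neutral element (1, 0), the value
    of each summand off its strip. As strips are disjoint, at most one summand differs from it at a
    given point. *)
Fixpoint partial_dipole k z : R * R :=
  if k is k'.+1 then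
    ((partial_dipole k' z).1 * (summand k' z).1,
     (partial_dipole k' z).2 + (summand k' z).2)
  else (1, 0).

Lemma partial_dipole_continuous k z : continuous_at z (partial_dipole k).
Proof.
elim: k => [|k IH]; first exact: cvg_cst.
have c1 (g : R * R -> R * R) : continuous_at z g ->
    continuous_at z (fun z => (g z).1) /\ continuous_at z (fun z => (g z).2).
  move=> cg; split.
    by apply: (@continuous_comp _ _ _ g fst) => //; exact: plane_continuous1.
  by apply: (@continuous_comp _ _ _ g snd) => //; exact: plane_continuous2.
have [? ?] := c1 _ IH; have [? ?] := c1 _ (@summand_continuous k z).
by apply: continuous_pair; [exact: continuous_mulr|exact: continuous_addr].
Qed.

Lemma partial_dipole_stable k l z : (k <= l)%N ->
  (forall n, (k <= n)%N -> summand n z = (1, 0)) ->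
  partial_dipole l z = partial_dipole k z.
Proof.
move=> kl h; rewrite -(subnKC kl); elim: (l - k)%N => [|i IH]; first by rewrite addn0.
rewrite addnS /= IH h ?leq_addr //= mulr1 addr0.
by rewrite -surjective_pairing.
Qed.

(** From this index on, no strip contains z. This holds at the origin too, where the quotient is 0
    by convention, since no strip contains the origin. *)
Definition rank z := (Num.truncn (2 / nsq z)).+1.

Definition dipole_sum z := partial_dipole (rank z) z.

Lemma summand_rank z n : (rank z <= n)%N -> summand n z = (1, 0).
Proof.
move=> zn; apply: summand_off => sz.
have z0 := strip_gt0 sz; have nz := strip_nsq sz.
have nz0 : 0 < nsq z.
  rewrite lt0r nsq_ge0 andbT nsq_eq0; apply: contraTneq z0 => ->.
  by rewrite ltxx.
have /andP[_ h] := truncn_itv (ltW (divr_gt0 (@ltr0Sn R 1) nz0)).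
move: nz; rewrite -ltr_pdivlMr // => h'.
have := lt_trans h' h; rewrite ltr_nat => h''.
by have := leq_trans h'' zn; rewrite ltnNge leqnSn.
Qed.

Lemma dipole_sumE z k : (forall n, (k <= n)%N -> summand n z = (1, 0)) ->
  dipole_sum z = partial_dipole k z.
Proof.
move=> h; rewrite /dipole_sum.
rewrite -(@partial_dipole_stable (rank z) (maxn (rank z) k)) ?leq_maxl //; last exact: summand_rank.
by rewrite -(@partial_dipole_stable k (maxn (rank z) k)) // leq_maxr.
Qed.

(** The rank may vary near z, so a common bound k is taken for all u with nsq u > nsq z / 2; this
    turns the 2 of [rank] into 4. *)
Lemma dipole_sum_continuous z : z != 0 -> continuous_at z dipole_sum.
Proof.
move=> z0; have nz0 : 0 < nsq z by rewrite lt0r nsq_ge0 andbT nsq_eq0.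
pose k := (Num.truncn (4 / nsq z)).+1.
have kE : \forall u \near z, dipole_sum u = partial_dipole k u.
  have : 0 < nsq z - nsq z / 2 by lra.
  move=> /(@near_gt0 R _ (fun u => nsq u - nsq z / 2)).
  have cn : continuous_at z (fun u => nsq u - nsq z / 2) by rewrite /nsq; continuity.
  move=> /(_ cn); apply: filterS => u hu; apply: dipole_sumE => n kn.
  apply: summand_off => /strip_nsq su.
  have /andP[_ h] := truncn_itv (ltW (divr_gt0 (@ltr0Sn R 3) nz0)).
  have {}h : 4 / nsq z < n.+1%:R.
    by apply: lt_le_trans h _; rewrite ler_nat (leq_trans kn) // leqnSn.
  move: h; rewrite ltr_pdivrMr // => h.
  have n0 : 0 < n.+1%:R :> R by [].
  nra.
have kz : dipole_sum z = partial_dipole k z by exact: nbhs_singleton kE.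
move=> N; rewrite kz => nN.
have nk : nbhs z (partial_dipole k @^-1` N) := @partial_dipole_continuous k z _ nN.
suff : nbhs z (dipole_sum @^-1` N) by [].
by apply: filterS (filterI kE nk) => u [] /= ->.
Qed.

Lemma partial_dipoleE k z :
  partial_dipole k z = (1, 0) \/
  exists n, [/\ (n < k)%N, strip n z & partial_dipole k z = summand n z].
Proof.
elim: k => [|k IH]; first by left.
have [sz|nsz] := pselect (strip k z); last first.
  have -> : partial_dipole k.+1 z = partial_dipole k z.
    by rewrite /= summand_off //= mulr1 addr0 -surjective_pairing.
  by case: IH => [|[n [nk sn E]]]; [left|right; exists n; split=> //; exact: ltnW].
right; exists k; split=> //=.
case: IH => [->|[n [nk sn _]]]; first by rewrite /= mul1r add0r -surjective_pairing.
by move: nk; rewrite (strip_disjoint sn sz) ltnn.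
Qed.

Lemma dipole_sum_strip n z : strip n z -> dipole_sum z = summand n z.
Proof.
move=> sz.
have off j : j != n -> summand j z = (1, 0).
  by move=> jn; apply: summand_off => /(strip_disjoint sz) nj; rewrite nj eqxx in jn.
rewrite (@dipole_sumE z n.+1); last by move=> j nj; rewrite off // gtn_eqF.
have -> : partial_dipole n.+1 z =
    ((partial_dipole n z).1 * (summand n z).1, (partial_dipole n z).2 + (summand n z).2) by [].
have [->|[j [jn sj _]]] := partial_dipoleE n z.
  by rewrite /= mul1r add0r -surjective_pairing.
by move: jn; rewrite (strip_disjoint sj sz) ltnn.
Qed.

Lemma dipole_sum_similar n u : nsq u < 2 ->
  dipole_sum (similar (m n) (e n) u) = if act n then dipole u else (1, 0).
Proof.
move=> u2; rewrite (dipole_sum_strip (strip_me n u2)) /summand.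
by rewrite similarK.
Qed.

Lemma dipole_sum_far z : 1 < `|z.1| \/ 1 < `|z.2| -> dipole_sum z = (1, 0).
Proof.
move=> far; rewrite (@dipole_sumE z 0) // => n _; apply: summand_off => /strip_box[h1 h2].
by case: far => h; [have := lt_trans h h1|have := lt_trans h h2]; rewrite ltxx.
Qed.

Lemma dipole_sum_eq0 z : dipole_sum z = 0 ->
  exists n, z = similar (m n) (e n) (1, 0) \/ z = similar (m n) (e n) (-1, 0).
Proof.
have n1 : (1, 0) <> 0 :> R * R by move=> /(congr1 fst) /eqP; rewrite /= oner_eq0.
rewrite /dipole_sum; have [->|[n [_ _ ->]]] := partial_dipoleE (rank z) z => // z0.
exists n; move: z0; rewrite /summand; case: (act n) => // /dipole_eq0.
by case=> <-; rewrite unsimilarK //; [left|right].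
Qed.

(** The function d of [root_cover_perforated], read in the chart. Its first factor enforces
    continuity at the origin, where [dipole_sum] may be discontinuous; the truncations keep the
    second factor bounded there and make the product 1 far away. *)
Definition defect z := Num.min 1 (nsq z) * Num.min 1 (nsq (dipole_sum z)).

Lemma defect_continuous z : continuous_at z defect.
Proof.
have [->|z0] := eqVneq z 0; last first.
  apply: continuous_mulr; first by rewrite /nsq; continuity.
  apply: continuous_minr; first exact: cvg_cst.
  apply: (@continuous_comp _ _ _ dipole_sum (@nsq R)).
    exact: dipole_sum_continuous.
  exact: nsq_continuous.
have d0 : defect 0 = 0.
  by rewrite /defect (eqP (_ : nsq (0 : R * R) == 0)) ?nsq_eq0 // min_r ?mul0r.
move=> N; rewrite d0 => /nbhs_ballP[eps /= eps0 sN].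
have : nbhs (0 : R * R) [set u | 0 < eps - nsq u].
  apply: (near_gt0 (g := fun u : R * R => eps - nsq u)).
    by rewrite /nsq; continuity.
  by rewrite (eqP (_ : nsq (0 : R * R) == 0)) ?nsq_eq0 // subr0.
suff sub : [set u | 0 < eps - nsq u] `<=` defect @^-1` N.
  by move=> h; suff : nbhs (0 : R * R) (defect @^-1` N) by []; exact: nbhs_sub h sub.
move=> u /= hu; apply: sN; rewrite /ball /= sub0r normrN.
have a0 : 0 <= Num.min 1 (nsq u) by rewrite le_min ler01 nsq_ge0.
have b0 : 0 <= Num.min 1 (nsq (dipole_sum u)) by rewrite le_min ler01 nsq_ge0.
rewrite ger0_norm ?mulr_ge0 //.
apply: (@le_lt_trans _ _ (nsq u)); last by lra.
apply: (@le_trans _ _ (Num.min 1 (nsq u) * 1)).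
  by rewrite ler_wpM2l // ge_min lexx.
by rewrite mulr1 ge_min lexx orbT.
Qed.

Lemma defect_gt0 z : (0 < defect z) = (z != 0) && (dipole_sum z != 0).
Proof.
have h (u : R * R) : (0 < Num.min 1 (nsq u)) = (u != 0).
  by rewrite lt_min ltr01 lt0r nsq_eq0 nsq_ge0 andbT.
have h0 (u : R * R) : 0 <= Num.min 1 (nsq u) by rewrite le_min ler01 nsq_ge0.
rewrite /defect -!h !lt0r mulf_eq0 negb_or mulr_ge0 // !h0.
by rewrite !andbT.
Qed.

Lemma defect_far z : 1 < `|z.1| \/ 1 < `|z.2| -> defect z = 1.
Proof.
move=> far; rewrite /defect dipole_sum_far // !min_l ?mulr1 //.
  by rewrite /nsq /= expr1n expr0n /= addr0.
have := sqr_ge0 z.1; have := sqr_ge0 z.2; rewrite /nsq.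
rewrite -(real_normK (num_real z.1)) -(real_normK (num_real z.2)).
by case: far; nra.
Qed.

End Sum.
End DipoleSum.

(** * Square roots over a disc, and those forced by an equivalence *)

Section Obstruction.
Variables (R : realType) (X : topologicalType) (A : set X).
Hypotheses (cA : countable A) (dA : dense A).

(** [kap] parametrises a disc in X. The set Y on which w is continuous will be the complement of A
    when connectedness is at stake, and a smaller set when an equivalence is. *)
Lemma no_root_on_disc (kap : R * R -> X) (Y : set X) (w : X -> R * R) :
  (forall u, nsq u < 2 -> continuous_at u kap) ->
  (forall u v, nsq u < 2 -> nsq v < 2 -> kap u = kap v -> u = v) ->
  (forall u, nsq u < 2 -> ~ A (kap u) -> Y (kap u)) ->
  continuous_on Y w ->
  ~ (forall u, nsq u < 2 -> ~ A (kap u) -> sq (w (kap u)) = dipole u).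
Proof.
move=> ckap ikap kY cw wroot.
pose A' := [set u : R * R | nsq u < 2] `&` kap @^-1` A.
have cA' : countable A'.
  move/countable_injP: cA => [g gi]; apply/countable_injP.
  exists (g \o kap) => u v /set_mem[u2 Au] /set_mem[v2 Av] /= guv.
  by apply: ikap => //; apply: gi => //; exact/mem_set.
apply: (@dipole_no_root R A' (w \o kap) cA') => [u [u2 Au] N nN|u u2 Au] /=.
  have nAu : ~ A (kap u) by move=> Ak; apply: Au.
  have nw : nbhs (kap u) [set y | Y y -> N (w y)] := cw _ (kY u u2 nAu) N nN.
  have nk : nbhs u (kap @^-1` [set y | Y y -> N (w y)]) := ckap u u2 _ nw.
  apply: (nbhs_sub nk) => v /= h [v2 Av]; apply: h; apply: kY => // Ak.
  by apply: Av.
by apply: wroot => // Ak; apply: Au.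
Qed.

(** Where g is (1, 0), its cover has the section x |-> (x, (1, 0)); the equivalence carries it to
    roots of f over the same points. *)
Lemma equivalent_root (f g : X -> R * R) :
  equivalent_coverings (@root_proj R X g (~` A)) (@root_proj R X f (~` A)) ->
  exists w : X -> R * R,
    continuous_on [set x | ~ A x /\ g x = (1, 0)] w /\
    forall x, ~ A x -> g x = (1, 0) -> sq (w x) = f x.
Proof.
move=> [h [[ch _] hP]].
have sq1 : sq ((1, 0) : R * R) = (1, 0).
  by rewrite /sq /= expr1n expr0n /= subr0 mulr0.
(* [None] is the value off the set, as no point of the cover is at hand there. *)
have /choice[ee eeP] x : exists ee : option (root_cover g (~` A)),
    ~ A x /\ g x = (1, 0) -> exists2 e, ee = Some e & base e = x /\ root e = (1, 0).
  have [[Ax gx]|nx] := pselect (~ A x /\ g x = (1, 0)); last by exists None.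
  have [|e eP] := @root_cover_point R X g (~` A) x (1, 0) Ax; first by rewrite sq1.
  by exists (Some e) => _; exists e.
exists (fun x => if ee x is Some e then root (h e) else 0); split; last first.
  move=> x Ax gx; have [e -> [ex er]] := eeP x (conj Ax gx).
  by rewrite rootP; have := congr1 val (hP e) => /= ->; rewrite ex.
move=> x xY N; have [e eE [ex er]] := eeP x xY; rewrite eE => nN.
have nr : nbhs (h e) [set e' | N (root e')] := @root_continuous R X f (~` A) (h e) N nN.
have nh : nbhs e [set e' | N (root (h e'))] := ch e _ nr.
have [M [[M1 M2] /= [nM1 nM2] sM] MN] := (nbhs_set_typeP _ _).1 nh.
have nx : nbhs x M1 by rewrite -ex.
apply: filterS nx => y M1y yY; have [e' e'E [e'y e'r]] := eeP y yY; rewrite e'E.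
apply: MN; apply: sM; split=> /=; first by rewrite -/(base e') e'y.
by rewrite -/(root e') e'r -er; exact: nbhs_singleton.
Qed.

Lemma dense_in_chart (psi : R * R -> X) (W : set (R * R)) :
  chart psi -> open W -> W !=set0 -> W `<=` box 1 ->
  W `&` [set z | A (psi z)] !=set0.
Proof.
move=> [_ _ opsi] oW [z Wz] sW.
have sW2 : W `<=` box 2.
  by move=> u /sW[h1 h2]; split; [apply: lt_trans h1 _|apply: lt_trans h2 _]; lra.
have oV : open (psi @` W).
  rewrite openE => _ [u Wu <-]; apply: opsi; first exact: sW2.
  exact: open_nbhs_nbhs.
have [_ [[u Wu <-] Au]] := dA (ex_intro _ _ (imageP psi Wz)) oV.
by exists u.
Qed.

End Obstruction.

Theorem corollary3p2 (R : realType) (Sigma : topologicalType) (A : set Sigma)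
  (hSigma : connected_surface R Sigma) (cA : countable A) (dA : dense A) :
  exists (E : (nat -> bool) -> topologicalType)
         (p : forall alpha, E alpha -> set_type (~` A)),
    (forall alpha, connected_regular_covering (p alpha) /\
                   perforated_surface R (E alpha)) /\
    (forall alpha beta, alpha <> beta ->
       ~ equivalent_coverings (p alpha) (p beta)).
Proof.
have [[hX pX lpX] [x0 _] _] := hSigma.
have [a [_ Aa]] : setT `&` A !=set0 by apply: dA; [exists x0|exact: openT].
have [psi psiC psi0] := locally_planar_chart a lpX.
have [cpsi ipsi opsi] := psiC.
have [phi [phiP phi3]] := chart_inverse psiC.
have /choice[me meP] n := @strip_disc R [set z | A (psi z)] n
  (fun W oW W0 sW => dense_in_chart dA psiC oW W0 sW).
have /choice[ee eeP] := meP.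
have e0 n : ee n != 0 by have [] := eeP n.
have strip_me n u : nsq u < 2 -> strip n (similar (me n) (ee n) u).
  by have [_ _ _ h] := eeP n; exact: h.
(* Disc 0 is always ramified, so that the total spaces are connected. *)
pose act (alpha : nat -> bool) n := if n is k.+1 then alpha k else true.
pose F alpha := dipole_sum me ee (act alpha).
pose kap n u := psi (similar (me n) (ee n) u).
have simbox n u : nsq u < 2 -> box 2 (similar (me n) (ee n) u).
  move=> /(strip_me n)/strip_box[h1 h2].
  by split; [apply: lt_trans h1 _|apply: lt_trans h2 _]; lra.
have ckap n u : nsq u < 2 -> continuous_at u (kap n).
  move=> u2; apply: (@continuous_comp _ _ _ (similar (me n) (ee n)) psi).
    exact: similar_continuous.
  by apply: cpsi; exact: simbox.
have ikap n u v : nsq u < 2 -> nsq v < 2 -> kap n u = kap n v -> u = v.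
  move=> u2 v2 /ipsi uv; apply: (can_inj (similarK (me n) (e0 n))).
  by apply: uv; exact: simbox.
have Fkap alpha n u : nsq u < 2 -> F alpha (phi (kap n u)) =
    if act alpha n then dipole u else (1, 0).
  move=> u2; rewrite phiP; last exact: simbox.
  by rewrite /F (@dipole_sum_similar R me ee (act alpha) e0 strip_me n u u2).
exists (fun alpha => root_cover (F alpha \o phi) (~` A)),
  (fun alpha => @root_proj R Sigma (F alpha \o phi) (~` A)).
split=> [alpha|alpha beta ab eqv]; last first.
  have [n an] : exists n, act alpha n <> act beta n.
    apply: contrapT => nn; apply: ab; apply/funext => k; apply: contrapT => abk.
    by apply: nn; exists k.+1.
  (* On disc n the function of [be] is 1, so an equivalence starting from its cover would give a
     root of the dipole that [al] has there. *)
  have contra (al be : nat -> bool) : act al n -> ~~ act be n ->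
      ~ equivalent_coverings (@root_proj R Sigma (F be \o phi) (~` A))
        (@root_proj R Sigma (F al \o phi) (~` A)).
    move=> aln ben /equivalent_root[w [cw wroot]].
    apply: (no_root_on_disc cA (ckap n) (ikap n) _ cw) => [u u2 nAu|u u2 nAu].
      by split=> //=; rewrite Fkap // (negbTE ben).
    rewrite wroot //= Fkap ?aln //.
    by rewrite (negbTE ben).
  case: (boolP (act beta n)) => bn'.
    apply: (contra beta alpha) => //; apply/negP => an'.
    by apply: an; rewrite an' bn'.
  apply: (contra alpha beta) => //.
    by apply: contrapT => /negP/negbTE an'; apply: an; rewrite an' (negbTE bn').
  (* Here [beta] is the one that is off, so the equivalence is inverted to start from its cover. *)
  have [h [[ch [k [ck hk kh]]] hP]] := eqv.
  by exists k; split=> [|x]; [split=> //; exists h|rewrite -hP kh].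
apply: (@root_cover_perforated R Sigma (F alpha \o phi)
  (defect me ee (act alpha) \o phi)) => //.
- move=> y; have [[z bz <-]|ny] := pselect ((psi @` box 2) y).
    apply: chart_inverse_continuous => //.
    exact: (defect_continuous e0 strip_me).
  apply: (@chart_extension_continuous R Sigma R psi phi (defect me ee (act alpha)) 1) => //.
  by move=> z; exact: defect_far.
- move=> y; rewrite /= defect_gt0 => /andP[y0 _].
  have [[z bz zy]|ny] := pselect ((psi @` box 2) y).
    rewrite -zy; apply: chart_inverse_continuous => //.
    by apply: dipole_sum_continuous => //; rewrite -(phiP z) // zy.
  apply: (@chart_extension_continuous R Sigma (R * R)%type psi phi (F alpha) (1, 0)) => //.
  by move=> z; exact: dipole_sum_far.
- by move=> y; rewrite /= defect_gt0 => /andP[].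
- move=> y nAy; rewrite /= defect_gt0.
  have [[z bz zy]|ny] := pselect ((psi @` box 2) y); last first.
    rewrite phi3 // dipole_sum_far //; last by left; rewrite /= gtr0_norm; lra.
    by apply/andP; split; apply/eqP => /(congr1 fst) /= /eqP; rewrite ?pnatr_eq0 ?oner_eq0.
  (* The origin is sent to a, and the zeros of the sum to points of A by the choice of the discs. *)
  rewrite -zy phiP //; apply/andP; split.
    by apply/eqP => z0; apply: nAy; rewrite -zy z0 psi0.
  apply/eqP => /(dipole_sum_eq0 e0 strip_me)[n zn]; apply: nAy; rewrite -zy.
  by have [_ D1 D2 _] := eeP n; case: zn => ->.
move=> [w [cw wroot]].
apply: (no_root_on_disc cA (ckap 0%N) (ikap 0%N) _ cw) => // u u2 nAu.
by rewrite wroot //= Fkap.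
Qed.
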